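(* Let $1\le p<\infty$. If $$\sum_{k\ge 1}\bigl(\mathbf{E}\,I_{p,k}\bigr)^{1/p}<\infty ,$$ then $S_n^{\mathrm V}/n$ converges in $L^p$ (and therefore also in probability and in distribution) to $S$ as $n\to\infty$.
   Context: Fix $\alpha\in[0,1]$ and a symmetric measurable cost function $\beta:(0,1)\times(0,1)\to[0,\infty)$ ($\beta(u,t)$ is the cost of comparing two keys with seeds $u\neq t$; values on the diagonal are irrelevant). Let $U_1,U_2,\dots$ be i.i.d. uniform$(0,1)$ random variables (the seeds). Put $L_0:=0$, $R_0:=1$ and, inductively for $k\ge 1$, $$\tau_k:=\inf\{i:\ L_{k-1}<U_i<R_{k-1}\},$$ $$L_k:=\mathbf 1(U_{\tau_k}<\alpha)\,U_{\tau_k}+\mathbf 1(U_{\tau_k}>\alpha)\,L_{k-1},\qquad R_k:=\mathbf 1(U_{\tau_k}<\alpha)\,R_{k-1}+\mathbf 1(U_{\tau_k}>\alpha)\,U_{\tau_k}.$$ (Almost surely all $\tau_k$ are finite and no $U_i$ equals $\alpha$.) For $n\ge1$ let $$S_{n,k}:=\sum_{i:\ \tau_k<i\le n}\mathbf 1(L_{k-1}<U_i<R_{k-1})\,\beta(U_i,U_{\tau_k}),\qquad S_n^{\mathrm V}:=\sum_{k\ge1}S_{n,k}.$$ ($S_n^{\mathrm V}$ has the distribution of the total cost of the algorithm QuickVal$(n,\alpha)$.) Further, $$I_k:=\int_{L_{k-1}}^{R_{k-1}}\beta(u,U_{\tau_k})\,du,\qquad I_{p,k}:=\int_{L_{k-1}}^{R_{k-1}}\beta^p(u,U_{\tau_k})\,du,\qquad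 S:=\sum_{k\ge1}I_k .$$ *)

(* Defs.v *)
From HB Require Import structures.
From mathcomp Require Import all_boot all_order all_algebra finmap.
From mathcomp Require Import all_classical all_reals all_analysis.
From mathcomp Require Import measurable_realfun.

Set Implicit Arguments.
Unset Strict Implicit.
Unset Printing Implicit Defensive.

Import Order.TTheory GRing.Theory Num.Theory.
Import numFieldNormedType.Exports.

Local Open Scope classical_set_scope.
Local Open Scope ring_scope.

(* The quantities of the QuickVal process are defined for one fixed sequence
   u of seeds.  Keys and rounds are numbered from 0: u i is U_{i+1}, and
   round k is the round numbered k+1 in the source, the one played in the
   interval (L_k, R_k).  So the condition i <= n on keys becomes i < n. *)

(* None encodes an infinite hitting time. *)
Definition first_in {R : realType} (u : nat -> R) (J : R * R) : option nat :=
  match pselect (exists i, J.1 < u i < J.2) with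
  | left h => Some (ex_minn h)
  | right _ => None
  end.

(* The pair (L_k, R_k).  On the null event that no seed falls in the current
   interval, the interval is kept. *)
Fixpoint interval_ {R : realType} (alpha : R) (u : nat -> R) (k : nat)
    : R * R :=
  if k is k'.+1 then
    let J := interval_ alpha u k' in
    if first_in u J is Some t then
      ((u t < alpha)%R%:R * u t + (alpha < u t)%R%:R * J.1,
       (u t < alpha)%R%:R * J.2 + (alpha < u t)%R%:R * u t)
    else J
  else (0, 1).

(* tau alpha u k is (up to the numbering of keys) the time tau_{k+1}. *)
Definition tau {R : realType} (alpha : R) (u : nat -> R) (k : nat)
    : option nat :=
  first_in u (interval_ alpha u k).

(* S_{n,k+1}; the sum is empty when tau_{k+1} is infinite. *)
Definition round_cost {R : realType} (beta : R -> R -> R) (alpha : R)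
    (u : nat -> R) (n k : nat) : R :=
  if tau alpha u k is Some t then
    \sum_(t.+1 <= i < n |
        (interval_ alpha u k).1 < u i < (interval_ alpha u k).2)
      beta (u i) (u t)
  else 0.

(* S_n^V *)
Definition quickval_cost {R : realType} (beta : R -> R -> R) (alpha : R)
    (u : nat -> R) (n : nat) : \bar R :=
  (\sum_(0 <= k <oo) (round_cost beta alpha u n k)%:E)%E.

(* I_{k+1} *)
Definition limit_round {R : realType} (beta : R -> R -> R) (alpha : R)
    (u : nat -> R) (k : nat) : \bar R :=
  if tau alpha u k is Some t then
    (\int[lebesgue_measure]_(x in
        `](interval_ alpha u k).1, (interval_ alpha u k).2[)
      (beta x (u t))%:E)%E
  else 0%E.

(* I_{p,k+1} *)
Definition limit_round_pow {R : realType} (beta : R -> R -> R) (alpha p : R)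
    (u : nat -> R) (k : nat) : \bar R :=
  if tau alpha u k is Some t then
    (\int[lebesgue_measure]_(x in
        `](interval_ alpha u k).1, (interval_ alpha u k).2[)
      (beta x (u t) `^ p)%:E)%E
  else 0%E.

(* S *)
Definition limit_cost {R : realType} (beta : R -> R -> R) (alpha : R)
    (u : nat -> R) : \bar R :=
  (\sum_(0 <= k <oo) limit_round beta alpha u k)%E.

(* Only the values on the open unit square are constrained. *)
Definition cost_function {R : realType} (beta : R -> R -> R) : Prop :=
  [/\ measurable_fun (`]0, 1[%classic `*` `]0, 1[%classic : set (R * R))
        (fun z => beta z.1 z.2),
      forall u t : R, 0 < u < 1 -> 0 < t < 1 -> 0 <= beta u t &
      forall u t : R, 0 < u < 1 -> 0 < t < 1 -> beta u t = beta t u].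

Definition mutually_independent {R : realType} {d : measure_display}
    {T : measurableType d} (P : probability T R) (X : nat -> {RV P >-> R})
    : Prop :=
  forall (J : {fset nat}) (B : nat -> set R),
    (forall i : nat, i \in J -> measurable (B i)) ->
    P (\bigcap_(i in [set` J]) (X i @^-1` B i)) =
    (\prod_(i <- J) P (X i @^-1` B i))%E.

Definition iid_uniform01 {R : realType} {d : measure_display}
    {T : measurableType d} (P : probability T R) (X : nat -> {RV P >-> R})
    : Prop :=
  mutually_independent X /\
  forall i (B : set R), measurable B ->
    distribution P (X i) B = uniform_prob (@ltr01 R) B.

(* Modes of convergence are stated for extended-real random variables,
   because S may be infinite on a null set. *)

Definition in_Lp {R : realType} {d : measure_display} {T : measurableType d}
    (P : probability T R) (p : R) (X : T -> \bar R) : Prop :=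
  measurable_fun [set: T] X /\ ('N[P]_p%:E[X] < +oo)%E.

Definition cvg_in_Lp {R : realType} {d : measure_display}
    {T : measurableType d} (P : probability T R) (p : R)
    (X_ : nat -> T -> \bar R) (X : T -> \bar R) : Prop :=
  [/\ forall n, in_Lp P p (X_ n),
      in_Lp P p X &
      ('N[P]_p%:E[(fun w => X_ n w - X w)])%E @[n --> \oo] --> 0%E].

Definition cvg_in_probability {R : realType} {d : measure_display}
    {T : measurableType d} (P : probability T R)
    (X_ : nat -> T -> \bar R) (X : T -> \bar R) : Prop :=
  forall e : R, 0 < e ->
    P [set w | (e%:E < `|X_ n w - X w|)%E] @[n --> \oo] --> 0%E.

(* Convergence of the distribution functions at every continuity point of the
   limit one; this is weak convergence on the real line when X is almost
   surely finite. *)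
Definition cvg_in_distribution {R : realType} {d : measure_display}
    {T : measurableType d} (P : probability T R)
    (X_ : nat -> T -> \bar R) (X : T -> \bar R) : Prop :=
  forall x : R,
    {for x, continuous (fun y : R => P [set w | (X w <= y%:E)%E])} ->
    P [set w | (X_ n w <= x%:E)%E] @[n --> \oo] -->
    P [set w | (X w <= x%:E)%E].

(* Main.v *)
(* Given the first i seeds, the i-th seed is uniform and independent of them.
   Hence each term of S_{n,k} has p-th moment at most E I_{p,k}, and by
   Minkowski both S_{n,k}/n and I_k have L^p norm at most (E I_{p,k})^(1/p),
   which is summable in k.  By dominated convergence for series it remains to
   show S_{n,k}/n -> I_k in L^p for each fixed k.  For a bounded cost, the
   differences between the terms of S_{n,k} and their conditional means are
   orthogonal, so S_{n,k}/n minus the Cesaro mean of the conditional means is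
   O(n^(-1/2)) in L^2, and these conditional means equal I_k as soon as
   tau_k < i; boundedness upgrades L^2 to L^p.  The general case follows by
   truncating the cost at a level M: the excess contributes at most twice its
   own moment bound, which tends to 0 as M grows. *)
Require Import Defs.
From HB Require Import structures.
From mathcomp Require Import all_boot all_order all_algebra finmap.
From mathcomp Require Import all_classical all_reals all_analysis.
From mathcomp Require Import measurable_realfun.

From mathcomp Require Import ring lra.

Set Implicit Arguments.
Unset Strict Implicit.
Unset Printing Implicit Defensive.

Import Order.TTheory GRing.Theory Num.Theory.
Import numFieldNormedType.Exports.

Local Open Scope classical_set_scope.
Local Open Scope ring_scope.

(** The obstacle is the random start of each sum: [S_{n,k}] begins after [tau_k], which depends on
    the seeds. It is removed by showing key [i] only the sequence cut off at [i]: the [i]-th summand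
    is then a function of the first [i] seeds and of [U i], and it vanishes by itself until the
    pivot has appeared. Conditioning on the past becomes Fubini for the law of the pair formed by
    the past and [U i]. The price is that the conditional mean of an early key is 0 instead of
    [I_k], and the Cesaro mean absorbs these finitely many terms. Facts about intervals and hitting
    times hold for every sequence of seeds, so no null set is carried along. Since [I_k] and [S] may
    be infinite, norms are those of extended-real functions; the costs from which they are
    subtracted are finite everywhere. *)

(** * The process for a fixed sequence of seeds *)

Section seed_sequences.
Context {R : realType}.
Implicit Types (u : nat -> R) (J : R * R) (k i n t : nat) (f : R -> R -> R).
Variable alpha : R.
Local Notation interval_ := (interval_ alpha).
Local Notation tau := (tau alpha).

Lemma first_in_Some u J t : first_in u J = Some t <->
  J.1 < u t < J.2 /\ forall j, (j < t)%N -> ~~ (J.1 < u j < J.2).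
Proof.
rewrite /first_in; case: pselect => [h|nh]; last first.
  by split=> // -[ut _]; exfalso; apply: nh; exists t.
case: ex_minnP => m um minm; split.
  move=> [<-]; split=> // j; apply: contraTN => /minm.
  by rewrite -leqNgt.
move=> [ut mint]; congr Some; apply/eqP; rewrite eqn_leq minm //= leqNgt.
by apply/negP => /mint; rewrite um.
Qed.

Lemma first_in_None u J :
  first_in u J = None <-> forall j, ~~ (J.1 < u j < J.2).
Proof.
rewrite /first_in; case: pselect => [[i ui]|nh].
  by split=> // /(_ i); rewrite ui.
by split=> // _ j; apply/negP => uj; apply: nh; exists j.
Qed.

Lemma interval_sub01 u k : 0 <= (interval_ u k).1 /\ (interval_ u k).2 <= 1.
Proof.
elim: k => [|k [ih1 ih2]] //=.
case E : first_in => [t|] //=; have [/andP[t1 t2] _] := (first_in_Some _ _ _).1 E.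
(* On a tie [u t = alpha] both indicators are 0 and the next interval is the empty [(0, 0)]; the
   third case covers this. *)
by case: (ltgtP (u t) alpha) => _;
  rewrite ?mul1r ?mul0r ?addr0 ?add0r //; split; lra.
Qed.

Lemma interval_subset u k x :
  (interval_ u k.+1).1 < x < (interval_ u k.+1).2 ->
  (interval_ u k).1 < x < (interval_ u k).2.
Proof.
move=> /=; case E : first_in => [t|] //=.
have [/andP[t1 t2] _] := (first_in_Some _ _ _).1 E.
by case: (ltgtP (u t) alpha) => _;
  rewrite ?mul1r ?mul0r ?addr0 ?add0r // => /andP[x1 x2]; apply/andP; split;
  lra.
Qed.

Lemma pivot_notin_next u k t : tau u k = Some t ->
  ~~ ((interval_ u k.+1).1 < u t < (interval_ u k.+1).2).
Proof.
rewrite /tau /= => ->.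
by case: (ltgtP (u t) alpha) => _ /=;
  rewrite ?mul1r ?mul0r ?addr0 ?add0r ?ltxx ?andbF //; apply/negP; lra.
Qed.

(** Every round rules out one more initial seed: the hit is the first seed in the interval, and the
    next interval leaves the hit out. Hence [tau_ge], by which only the first [n] rounds contribute
    to [S_n^V]. *)
Lemma early_seeds_notin u k j : (j < k)%N ->
  ~~ ((interval_ u k).1 < u j < (interval_ u k).2).
Proof.
elim: k j => // k ih j; rewrite ltnS leq_eqVlt => /orP[/eqP ->|jk]; last first.
  by apply: contra (ih _ jk); exact: interval_subset.
case E : (tau u k) => [t|]; last first.
  by apply: contra ((first_in_None _ _).1 E k); exact: interval_subset.
have [ut mint] := (first_in_Some _ _ _).1 E.
have [tk|kt|tk] := ltngtP t k; last by subst t; exact: pivot_notin_next E.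
- by have := ih _ tk; rewrite ut.
- by apply: contra (mint _ kt); exact: interval_subset.
Qed.

Lemma tau_ge u k t : tau u k = Some t -> (k <= t)%N.
Proof.
move=> /first_in_Some[ut _]; rewrite leqNgt; apply/negP => /(early_seeds_notin u).
by rewrite ut.
Qed.

(* 0 lies in no open interval (L_k, R_k), so the process run on [trunc i u]
   sees the first [i] seeds only. *)
Definition trunc i u : nat -> R := fun j => if (j < i)%N then u j else 0.

Lemma trunc_trunc i n u : (i <= n)%N -> trunc i (trunc n u) = trunc i u.
Proof.
move=> i_n; apply/funext => j; rewrite /trunc; case: ifPn => // ji.
by rewrite (leq_trans ji i_n).
Qed.

Definition before (o : option nat) i : bool :=
  if o is Some t then (t < i)%N else false.

Lemma first_in_trunc u J i : 0 <= J.1 ->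
  first_in (trunc i u) J =
  if before (first_in u J) i then first_in u J else None.
Proof.
move=> J0.
have late j : (i <= j)%N -> ~~ (J.1 < trunc i u j < J.2).
  by rewrite /trunc leqNgt => /negbTE ->; rewrite ltNge J0.
have early j : (j < i)%N -> trunc i u j = u j by rewrite /trunc => ->.
case E : (first_in u J) => [t|] /=; last first.
  have nou := (first_in_None _ _).1 E.
  apply/first_in_None => j; have [/late//|ji] := leqP i j.
  by rewrite early.
have [ut mint] := (first_in_Some _ _ _).1 E.
case: ifPn => [ti|]; last first.
  rewrite -leqNgt => it; apply/first_in_None => j; have [/late//|ji] := leqP i j.
  by rewrite early// mint// (leq_trans ji).
apply/first_in_Some; split=> [|j jt]; first by rewrite early.
by rewrite early ?mint// (ltn_trans jt).
Qed.

(** Once none of the first [i] seeds hits the current interval, the truncated process stands still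
    and its intervals may differ from the true ones. From that round on neither process has a hit
    before [i], which is what [tau_trunc] requires. *)
Lemma interval_trunc u i k :
  interval_ (trunc i u) k = interval_ u k \/
  (~~ before (tau u k) i /\ tau (trunc i u) k = None).
Proof.
elim: k => [|k ih]; first by left.
have none v : tau v k = None -> tau v k.+1 = None.
  by rewrite /tau /= => E; rewrite E.
have latemono : ~~ before (tau u k) i -> ~~ before (tau u k.+1) i.
  move=> nb; case E : (tau u k.+1) => [t|//] /=; rewrite -leqNgt.
  have [/interval_subset ut _] := (first_in_Some _ _ _).1 E.
  move: nb; case E' : (tau u k) => [s|]; last first.
    by move: ut; rewrite (negbTE ((first_in_None _ _).1 E' t)).
  rewrite /= -leqNgt => /leq_trans; apply.
  rewrite leqNgt; apply/negP => ts.
  by have [_ /(_ _ ts)] := (first_in_Some _ _ _).1 E'; rewrite ut.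
case: ih => [ih|[nb nn]]; last by right; split; [exact: latemono|exact: none].
have E : tau (trunc i u) k = if before (tau u k) i then tau u k else None.
  by rewrite /tau ih first_in_trunc//; have [] := interval_sub01 u k.
move: E; case: ifPn => [b E|nb E].
  left; rewrite /=; move: E; rewrite /tau => ->; rewrite ih.
  move: b; rewrite /tau; case: first_in => //= t ti.
  by rewrite /trunc ti.
by right; split; [exact: latemono|exact: none].
Qed.

Lemma tau_trunc u i k :
  tau (trunc i u) k = if before (tau u k) i then tau u k else None.
Proof.
have [E|[/negbTE -> ->//]] := interval_trunc u i k.
by rewrite /tau E first_in_trunc//; have [] := interval_sub01 u k.
Qed.

(* With [trunc i u] in place of [u] this vanishes unless the pivot of round [k]
   comes before key [i], which makes S_{n,k+1} a sum over all [i < n]. *)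
Definition key_cost f u k (x : R) : R :=
  if tau u k is Some t then
    ((interval_ u k).1 < x < (interval_ u k).2)%R%:R * f x (u t)
  else 0.

Lemma key_cost_trunc f u i k x :
  key_cost f (trunc i u) k x = (before (tau u k) i)%:R * key_cost f u k x.
Proof.
rewrite /key_cost tau_trunc; case: ifPn => [b|_]; last by rewrite mul0r.
rewrite mul1r; have [->|[/negP//]] := interval_trunc u i k.
by move: b; case: (tau u k) => //= t ti; rewrite /trunc ti.
Qed.

Lemma key_cost_out f u k x : ~~ (0 < x < 1) -> key_cost f u k x = 0.
Proof.
move=> x01; rewrite /key_cost; case: tau => // t.
have [h1 h2] := interval_sub01 u k.
case: (boolP (_ && _)) => [|_]; last by rewrite mul0r.
by move=> /andP[]; move: x01 => /negP; lra.
Qed.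

Lemma eq_key_cost f g u k x :
  (forall x y, 0 < x < 1 -> 0 < y < 1 -> f x y = g x y) ->
  key_cost f u k x = key_cost g u k x.
Proof.
move=> fg; rewrite /key_cost; case E : tau => [t|//].
have [h1 h2] := interval_sub01 u k.
have [/andP[t1 t2] _] := (first_in_Some _ _ _).1 E.
case: (boolP (_ && _)) => [|_]; last by rewrite !mul0r.
by move=> /andP[x1 x2]; rewrite fg//; apply/andP; split; lra.
Qed.

Lemma key_cost_ge0 f u k x : (forall x y, 0 <= f x y) -> 0 <= key_cost f u k x.
Proof. by move=> f0; rewrite /key_cost; case: tau => // t; rewrite mulr_ge0. Qed.

Lemma key_cost_le f u k x M : 0 <= M ->
  (forall x y, f x y <= M) -> key_cost f u k x <= M.
Proof.
move=> M0 fM; rewrite /key_cost; case: tau => // t.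
by case: (_ && _); rewrite ?mul1r ?mul0r.
Qed.

Lemma key_costD f g u k x :
  key_cost (fun x y => f x y + g x y) u k x =
  key_cost f u k x + key_cost g u k x.
Proof. by rewrite /key_cost; case: tau => [t|]; rewrite ?addr0// mulrDr. Qed.

(** An indicator equals its own [p]-th power, with [p != 0] because [0 ^ 0 = 1]. Thus [p]-th moments
    for the cost [f] are first moments for the cost [f ^ p]. *)
Lemma key_cost_powR f p u k x : p != 0 ->
  key_cost (fun x y => f x y `^ p) u k x = key_cost f u k x `^ p.
Proof.
move=> p0; rewrite /key_cost; case: tau => [t|]; last by rewrite powR0.
by case: (_ && _); rewrite ?mul1r ?mul0r// powR0.
Qed.

Lemma round_costE f u n k : round_cost f alpha u n k =
  \sum_(i < n) key_cost f (trunc i u) k (u i).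
Proof.
under eq_bigr do rewrite key_cost_trunc.
rewrite /round_cost /key_cost; case: tau => [t|]; last first.
  by rewrite big1// => i _; rewrite mul0r.
rewrite -(big_mkord xpredT (fun i => (before (Some t) i)%:R *
  (((interval_ u k).1 < u i < (interval_ u k).2)%R%:R * f (u i) (u t)))) /=.
have [tn|nt] := ltnP t n; last first.
  rewrite big_geq 1?leqW// big_nat big1// => i /= i_n.
  by rewrite ltnNge (leq_trans (ltnW i_n) nt) mul0r.
(* The cut is at [t.+1], not [t]: the pivot is not before itself and pays nothing. *)
rewrite [RHS](@big_cat_nat _ _ _ t.+1) //= [X in _ = X + _]big_nat.
rewrite [X in _ = X + _]big1 ?add0r.
  rewrite big_mkcond big_nat [RHS]big_nat; apply: eq_bigr => i /andP[ti _].
  by rewrite ti mul1r; case: (_ && _); rewrite ?mul1r ?mul0r.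
by move=> i /=; rewrite ltnS leqNgt => /negbTE ->; rewrite mul0r.
Qed.

Lemma round_cost_eq0 f u n k : (n <= k)%N -> round_cost f alpha u n k = 0.
Proof.
move=> nk; rewrite /round_cost; case E : tau => [t|//].
by rewrite big_geq// (leq_trans nk)// leqW// (tau_ge E).
Qed.

Lemma limit_roundE f u k : limit_round f alpha u k =
  (\int[lebesgue_measure]_x (key_cost f u k x)%:E)%E.
Proof.
rewrite /limit_round /key_cost; case E : tau => [t|]; last by rewrite integral0.
rewrite integral_mkcond; apply: eq_integral => x _; rewrite patchE.
rewrite mem_setE in_itv /=.
by case: (_ && _); rewrite ?mul1r ?mul0r.
Qed.

End seed_sequences.

(** * Measurability of intervals and hitting times *)

Section measurability.
Context {R : realType} {d : measure_display} {T : measurableType d}.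
Variables (alpha : R) (v : nat -> T -> R).
Hypothesis mv : forall j, measurable_fun [set: T] (v j).
Implicit Types (w : T) (k i n t : nat).
Local Notation J k w := (interval_ alpha (v^~ w) k).

(** A random index with countably many values may be substituted: preimages split along the fibres
    of [h]. It handles the pivot, a seed with a random index. *)
Lemma measurable_fun_fibers d' (T' : measurableType d') (I : countType)
    (h : T -> I) (g : I -> T -> T') :
  (forall o, measurable (h @^-1` [set o])) ->
  (forall o, measurable_fun [set: T] (g o)) ->
  measurable_fun [set: T] (fun w => g (h w) w).
Proof.
move=> mh mg _ B mB; rewrite setTI.
rewrite (_ : _ @^-1` _ = \bigcup_n
  (if @choice.unpickle I n is Some o
   then h @^-1` [set o] `&` g o @^-1` B else set0)).
  apply: bigcupT_measurable => n; case: choice.unpickle => // o.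
  by apply: measurableI => //; rewrite -(setTI (_ @^-1` B)); exact: mg.
apply/seteqP; split=> w /=.
  by exists (choice.pickle (h w)); rewrite ?choice.pickleK.
by move=> [n _]; case: choice.unpickle => // o; move=> [<-].
Qed.

Lemma measurable_first_in (a b : T -> R) o :
  measurable_fun [set: T] a -> measurable_fun [set: T] b ->
  measurable ((fun w => first_in (v^~ w) (a w, b w)) @^-1` [set o]).
Proof.
move=> ma mb; pose H j := [set w | a w < v j w < b w].
have mH j : measurable (H j).
  rewrite /H -[X in measurable X]setTI.
  by apply: (measurable_and (measurable_fun_ltr ma (mv j))
                            (measurable_fun_ltr (mv j) mb)).
have mt t :
    measurable ((fun w => first_in (v^~ w) (a w, b w)) @^-1` [set Some t]).
  rewrite (_ : _ @^-1` _ = H t `&` \bigcap_(j in `I_t) ~` H j).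
    apply: measurableI => //; apply: fin_bigcap_measurable => // j _.
    exact: measurableC.
  apply/seteqP; split=> w /=.
    move=> /first_in_Some[ut mint]; split=> // j /mint /negP; exact.
  by move=> [ut mint]; apply/first_in_Some; split=> // j /mint /negP.
case: o => [t|]; first exact: mt.
(* An infinite hitting time is the complement of the countably many finite ones. *)
rewrite (_ : _ @^-1` _ = ~` \bigcup_t
  ((fun w => first_in (v^~ w) (a w, b w)) @^-1` [set Some t])).
  by apply: measurableC; exact: bigcupT_measurable.
apply/seteqP; split=> w /=; first by move=> E [t _ /=]; rewrite E.
by case E: first_in => [t|//] []; exists t.
Qed.

Lemma measurable_interval k : measurable_fun [set: T] (fun w => J k w).
Proof.
elim: k => [|k ih]; first exact: measurable_cst.
have [ih1 ih2] := (measurable_fun_pairP _).1 ih.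
have mfi o : measurable ((fun w => first_in (v^~ w) (J k w)) @^-1` [set o]).
  rewrite (_ : (fun w => _) =
    (fun w => first_in (v^~ w) ((J k w).1, (J k w).2))).
    exact: measurable_first_in.
  by apply/funext => w; rewrite -surjective_pairing.
have mind (b : T -> bool) : measurable_fun [set: T] b ->
    measurable_fun [set: T] (fun w => (b w)%:R : R).
  move=> mb; rewrite (_ : (fun w => _) = (fun w => if b w then 1 else 0)).
    exact: measurable_fun_ifT.
  by apply/funext => w; case: (b w).
pose g o w := if o is Some t then
    ((v t w < alpha)%R%:R * v t w + (alpha < v t w)%R%:R * (J k w).1,
     (v t w < alpha)%R%:R * (J k w).2 + (alpha < v t w)%R%:R * v t w)
  else J k w.
apply: (measurable_fun_fibers (g := g) mfi) => -[t|//].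
have mlt : measurable_fun [set: T] (fun w => (v t w < alpha)%R%:R : R).
  by apply: mind; exact: measurable_fun_ltr.
have mgt : measurable_fun [set: T] (fun w => (alpha < v t w)%R%:R : R).
  by apply: mind; exact: measurable_fun_ltr.
by apply: measurable_fun_pair; apply: measurable_funD; apply: measurable_funM.
Qed.

Lemma measurable_tau k o :
  measurable ((fun w => tau alpha (v^~ w) k) @^-1` [set o]).
Proof.
have [ih1 ih2] := (measurable_fun_pairP _).1 (measurable_interval k).
rewrite (_ : (fun w => _) =
  (fun w => first_in (v^~ w) ((J k w).1, (J k w).2))).
  exact: measurable_first_in.
by apply/funext => w; rewrite -surjective_pairing.
Qed.

End measurability.

(** * Measurability of key costs and limit rounds *)

Section measurable_key_cost.
Context {R : realType} {d : measure_display} {T : measurableType d}.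
Variables (alpha : R) (v : nat -> T -> R) (f : R -> R -> R).
Hypothesis mv : forall j, measurable_fun [set: T] (v j).
Hypothesis mf : measurable_fun [set: R * R] (fun z => f z.1 z.2).
Hypothesis f0 : forall x y, 0 <= f x y.
Implicit Types (w : T) (k i n t : nat).

(** Joint measurability in the sample point and the key: Tonelli then makes [limit_round]
    measurable, and a random key can be substituted. *)
Lemma measurable_key_cost k : measurable_fun [set: T * R]
  (fun z => key_cost alpha f (v^~ z.1) k z.2).
Proof.
have mv1 j : measurable_fun [set: T * R] (v j \o fst).
  exact: measurableT_comp.
have mJ := measurable_interval (T := (T * R)%type) alpha mv1 k.
have [/= mJ1 mJ2] := (measurable_fun_pairP _).1 mJ.
pose g o (z : T * R) : R := if o is Some t then
  ((interval_ alpha (v^~ z.1) k).1 < z.2 < (interval_ alpha (v^~ z.1) k).2)%R%:R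
   * f z.2 (v t z.1) else 0.
apply: (measurable_fun_fibers (g := g) (measurable_tau alpha mv1 k)) => -[t|];
  last exact: measurable_cst.
apply: measurable_funM; last first.
  apply: (measurableT_comp (f := fun z : R * R => f z.1 z.2)
    (g := fun z : T * R => (z.2, v t z.1))) => //.
  by apply: measurable_fun_pair => //; exact: mv1.
rewrite (_ : (fun z => _) = (fun z : T * R => if (interval_ alpha (v^~ z.1) k).1
  < z.2 < (interval_ alpha (v^~ z.1) k).2 then 1 else 0)); last first.
  by apply/funext => z; case: (_ && _).
apply: measurable_fun_ifT => //.
by apply: measurable_and; apply: measurable_fun_ltr.
Qed.

Lemma measurable_limit_round k :
  measurable_fun [set: T] (fun w => limit_round f alpha (v^~ w) k).
Proof.
under eq_fun do rewrite limit_roundE.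
apply: (@measurable_fun_fubini_tonelli_F _ _ _ _ _ (@lebesgue_measure R)
  (fun z => (key_cost alpha f (v^~ z.1) k z.2)%:E)).
  by apply/measurable_EFinP; exact: measurable_key_cost.
by move=> z; rewrite lee_fin key_cost_ge0.
Qed.

Lemma measurable_key_cost_comp k (g : T -> R) : measurable_fun [set: T] g ->
  measurable_fun [set: T] (fun w => key_cost alpha f (v^~ w) k (g w)).
Proof.
move=> mg; apply: (measurableT_comp (g := fun w => (w, g w))
  (measurable_key_cost k)).
exact: measurable_fun_pair.
Qed.

Lemma measurable_trunc i j :
  measurable_fun [set: T] (fun w => trunc i (v^~ w) j).
Proof. by rewrite /trunc; case: (j < i)%N. Qed.

End measurable_key_cost.

(** * Independence of a seed from the earlier ones *)

Section independence_of_the_past.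
Context {R : realType} {d : measure_display} {T : measurableType d}.
Variables (P : probability T R) (U : nat -> {RV P >-> R}).
Hypothesis hU : iid_uniform01 U.
Variable n : nat.

Local Notation unif := (uniform_prob (@ltr01 R)).

(** A pi-system generating the sigma-algebra of the first [n] seeds. The type [past] is [T] with
    this coarser sigma-algebra, so being measurable on [past] means depending on those seeds
    only. *)
Definition past_cylinders : set (set T) :=
  [set A | exists B : nat -> set R, (forall i, measurable (B i)) /\
    A = \bigcap_(i in `I_n) (U i @^-1` B i)].

Local Notation past := (g_sigma_algebraType past_cylinders).

Lemma setI_closed_past_cylinders : setI_closed past_cylinders.
Proof.
move=> _ _ [A [mA ->]] [B [mB ->]].
exists (fun i => A i `&` B i); split; first by move=> i; exact: measurableI.
by rewrite -bigcapI.
Qed.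

Lemma past_cylinder_measurable A : past_cylinders A -> measurable A.
Proof.
move=> [B [mB ->]]; apply: fin_bigcap_measurable => // i _.
by rewrite -[X in measurable X]setTI; exact: measurable_funP.
Qed.

Lemma measurable_to_past :
  measurable_fun [set: T] (fun w : T => (w : past)).
Proof.
apply: (@measurability _ _ T past setT (fun w => w) past_cylinders) => //.
by move=> _ [A /past_cylinder_measurable mA <-]; rewrite setTI.
Qed.

Lemma measurable_past i : (i < n)%N ->
  measurable_fun [set: past] (U i : past -> R).
Proof.
move=> i_n _ B mB; rewrite setTI; apply: sub_sigma_algebra.
exists (fun j => if j == i then B else setT); split.
  by move=> j; case: ifP.
apply/seteqP; split=> w /=; first by move=> Bw j _ /=; case: eqP => [->|].
by move=> /(_ i i_n) /=; rewrite eqxx.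
Qed.

Lemma independent_initial (B : nat -> set R) m :
  (forall i, measurable (B i)) ->
  P (\bigcap_(i in `I_m) (U i @^-1` B i)) =
  (\prod_(i < m) P (U i @^-1` B i))%E.
Proof.
have [indep _] := hU; move=> mB.
pose J := [fset i in iota 0 m]%fset.
have inJ i : (i \in J) = (i < m)%N by rewrite !inE mem_iota add0n.
have := @indep J B (fun i _ => mB i).
rewrite (perm_big (iota 0 m)); last first.
  apply: uniq_perm; rewrite ?fset_uniq ?iota_uniq// => i.
  by rewrite mem_iota add0n -inJ.
rewrite -[X in \big[_/_]_(i <- iota 0 X) _]subn0 big_mkord => <-.
congr (P _); apply: eq_bigcapl; split=> i /=; by rewrite inJ.
Qed.

Lemma past_seed_independent (A : set T) (B : set R) :
  past_cylinders A -> measurable B ->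
  P (A `&` U n @^-1` B) = (P A * P (U n @^-1` B))%E.
Proof.
move=> [C [mC ->]] mB.
pose C' i := if (i < n)%N then C i else B.
have mC' i : measurable (C' i) by rewrite /C'; case: ifP.
have C'C i : (i < n)%N -> C' i = C i by rewrite /C' => ->.
have C'n : C' n = B by rewrite /C' ltnn.
transitivity (P (\bigcap_(i in `I_n.+1) (U i @^-1` C' i))).
  congr (P _); rewrite IIS bigcap_setU bigcap_set1 C'n; congr (_ `&` _).
  by apply: eq_bigcapr => i /= /C'C ->.
rewrite independent_initial// big_ord_recr/= C'n independent_initial//.
by congr (_ * _)%E; apply: eq_bigr => i _; rewrite C'C.
Qed.

(** For fixed [B] both sides are finite measures in [A]. They agree on the pi-system of cylinders,
    hence on the sigma-algebra it generates. *)
Lemma past_measurable_seed_independent (A : set past) (B : set R) :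
  measurable A -> measurable B ->
  P (A `&` U n @^-1` B) = (P A * unif B)%E.
Proof.
move=> mA mB; have [_ unifU] := hU; rewrite -(unifU n B mB).
have mUB : measurable (U n @^-1` B).
  by rewrite -[X in measurable X]setTI; exact: measurable_funP.
have pos : 0 <= fine (P (U n @^-1` B)) by rewrite fine_ge0.
pose m1 : {measure set T -> \bar R} := mrestr P mUB.
pose m2 : {measure set T -> \bar R} := mscale (NngNum pos) P.
have Pfin : P (U n @^-1` B) \is a fin_num by rewrite fin_num_measure.
have -> : (P A * distribution P (U n) B = m2 A)%E.
  by rewrite /m2 /= /mscale /= fineK// muleC.
apply: (@g_sigma_algebra_measure_unique _ _ T past_cylinders
  past_cylinder_measurable (fun=> setT) _ _ m1 m2 setI_closed_past_cylinders
  _ _ A mA).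
- move=> _; exists (fun=> setT); split=> //.
  by apply/seteqP; split.
- by apply/seteqP; split=> // x _; exists 0%N.
- move=> C pC; rewrite /m1 /m2 /= /mrestr /mscale /= fineK// muleC.
  exact: past_seed_independent.
- move=> _; rewrite /m1 /= /mrestr setTI.
  by rewrite ltey_eq Pfin.
Qed.

Definition to_past (w : T) : past := w.
HB.instance Definition _ := isMeasurableFun.Build _ _ T past to_past
  measurable_to_past.

Definition past_and_seed (w : T) : past * measurableTypeR R :=
  (to_past w, U n w).

Lemma measurable_past_and_seed : measurable_fun [set: T] past_and_seed.
Proof.
apply: measurable_fun_pair; first exact: measurable_to_past.
exact: (measurable_funP (U n)).
Qed.
HB.instance Definition _ := isMeasurableFun.Build _ _ T
  (past * measurableTypeR R)%type past_and_seed measurable_past_and_seed.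

Local Open Scope ereal_scope.

Lemma distribution_past_and_seed (X : set (past * measurableTypeR R)) :
  measurable X ->
  (distribution P to_past \x unif) X = distribution P past_and_seed X.
Proof.
move=> mX; apply: (@product_measure_unique _ _ past (measurableTypeR R) R
  (distribution P to_past) unif (distribution P past_and_seed)) => // A B mA mB.
rewrite -past_measurable_seed_independent//.
Qed.

(** The freezing lemma: the law of the pair is a product, so the new seed is integrated out with the
    past held fixed. It stands in for conditional expectation given the first [n] seeds. *)
Lemma ge0_integral_past_and_seed (F : past * measurableTypeR R -> \bar R) :
  measurable_fun setT F -> (forall z, 0 <= F z) ->
  \int[P]_w F (w, U n w) = \int[P]_w \int[unif]_x F (w, x).
Proof.
move=> mF F0.
rewrite -[LHS](ge0_integral_distribution past_and_seed mF F0).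
rewrite -(eq_measure_integral _ (fun X mX _ => distribution_past_and_seed mX)).
rewrite fubini_tonelli1// ge0_integral_distribution//.
  exact: measurable_fun_fubini_tonelli_F.
by move=> y; apply: integral_ge0 => x _; exact: F0.
Qed.

(** The signed version, for the centred key costs. *)
Lemma integral_past_and_seed (F : past * measurableTypeR R -> \bar R) :
  measurable_fun setT F ->
  \int[P]_w \int[unif]_x `|F (w, x)| < +oo ->
  \int[P]_w F (w, U n w) = \int[P]_w \int[unif]_x F (w, x).
Proof.
move=> mF iF.
have maF : measurable_fun setT (abse \o F) by exact: measurableT_comp.
have iF1 : (distribution P to_past \x unif).-integrable setT F.
  apply/integrable12ltyP => //; rewrite ge0_integral_distribution//.
    apply: (@measurable_fun_fubini_tonelli_F _ _ _ _ _ unif (abse \o F)) => // z.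
    exact: abse_ge0.
  by move=> y; apply: integral_ge0.
have iF2 : P.-integrable setT (F \o past_and_seed).
  apply/integrableP; split; first exact: measurableT_comp.
  by rewrite (@ge0_integral_past_and_seed (abse \o F)) // => z; exact: abse_ge0.
rewrite -[LHS](integral_distribution mF iF2).
rewrite -(eq_measure_integral _ (fun X mX _ => distribution_past_and_seed mX)).
rewrite -integral12_prod_meas1// integral_distribution//.
  exact: (measurable_fubini_F iF1).
have /integrable_fubini_F/integrableP[mG iG] := iF1.
apply/integrableP; split; first exact: measurableT_comp.
rewrite ge0_integral_distribution// in iG.
exact: measurableT_comp.
Qed.

End independence_of_the_past.

(** * Norms of extended-real functions and Minkowski for series *)

Section Lnorm_ereal.
Context {R : realType} {d : measure_display} {T : measurableType d}.
Variable mu : {measure set T -> \bar R}.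
Variable p : R.
Hypothesis p1 : 1 <= p.
Local Open Scope ereal_scope.
Implicit Types f g : T -> \bar R.

Let p0 : (0 < p)%R. Proof. exact: lt_le_trans ltr01 p1. Qed.
Let pN0 : p != 0%R. Proof. by rewrite gt_eqF. Qed.

Lemma ge0_le_poweR (x y : \bar R) (r : R) : (0 <= r)%R -> 0 <= x -> x <= y ->
  x `^ r <= y `^ r.
Proof.
move=> r0 x0 xy; apply: gt0_ler_poweR => //; rewrite in_itv/= leey andbT//.
exact: le_trans xy.
Qed.

Lemma poweRK (x : \bar R) (r : R) : r != 0%R -> 0 <= x -> (x `^ r) `^ r^-1 = x.
Proof. by move=> r0 x0; rewrite -poweRrM divff// poweRe1. Qed.

Lemma poweRVK (x : \bar R) (r : R) : r != 0%R -> 0 <= x -> (x `^ r^-1) `^ r = x.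
Proof. by move=> r0 x0; rewrite -poweRrM mulVf// poweRe1. Qed.

Lemma LnormE f : 'N[mu]_p%:E[f] = (\int[mu]_x `|f x| `^ p) `^ p^-1.
Proof. by rewrite unlock. Qed.

Lemma measurable_abse_poweR f : measurable_fun setT f ->
  measurable_fun setT (fun x => `|f x| `^ p).
Proof.
move=> mf; apply: (measurableT_comp (measurable_poweR p)).
exact: measurableT_comp.
Qed.

Lemma le_Lnorm f g : measurable_fun setT f -> measurable_fun setT g ->
  (forall x, `|f x| <= `|g x|) -> 'N[mu]_p%:E[f] <= 'N[mu]_p%:E[g].
Proof.
move=> mf mg fg; rewrite !LnormE; apply: ge0_le_poweR.
- by rewrite invr_ge0 ltW.
- by apply: integral_ge0 => x _; exact: poweR_ge0.
- apply: ge0_le_integral => //; try exact: measurable_abse_poweR.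
  + by move=> x _; exact: poweR_ge0.
  + by move=> x _; apply: ge0_le_poweR => //; exact: ltW.
Qed.

Lemma ge0_LnormZ f (c : R) : measurable_fun setT f -> (0 <= c)%R ->
  'N[mu]_p%:E[(fun x => c%:E * f x)] = c%:E * 'N[mu]_p%:E[f].
Proof.
move=> mf c0; rewrite !LnormE.
under eq_integral => x _ do
  rewrite abseM (@gee0_abs _ c%:E) ?lee_fin// poweRM ?lee_fin// poweR_EFin.
rewrite ge0_integralZl_EFin ?powR_ge0//; last 2 first.
- by move=> x _; exact: poweR_ge0.
- exact: measurable_abse_poweR.
rewrite poweRM ?lee_fin ?powR_ge0//; last first.
  by apply: integral_ge0 => x _; exact: poweR_ge0.
by rewrite poweR_EFin -powRrM divff// powRr1.
Qed.

Lemma ae_eq_Lnorm f g : measurable_fun setT f -> measurable_fun setT g ->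
  ae_eq mu setT f g -> 'N[mu]_p%:E[f] = 'N[mu]_p%:E[g].
Proof.
move=> mf mg fg; rewrite !LnormE; congr (_ `^ _).
apply: ae_eq_integral => //; try exact: measurable_abse_poweR.
by apply: filterS fg => x /= /(_ I) ->.
Qed.

Lemma Lnorm_lty_ae_fin f : measurable_fun setT f ->
  'N[mu]_p%:E[f] < +oo -> ae_eq mu setT f (EFin \o (fine \o f)).
Proof.
move=> mf; rewrite LnormE => /lty_poweRy foo.
have /integrable_ae : mu.-integrable setT (fun x => `|f x| `^ p).
  apply/integrableP; split; first exact: measurable_abse_poweR.
  under eq_integral do rewrite gee0_abs ?poweR_ge0//.
  by apply: foo; rewrite invr_neq0.
move=> /(_ measurableT); apply: filterS => x /(_ I) fx _ /=.
rewrite fineK// fin_num_abs (lty_poweRy pN0)//.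
by move: fx; rewrite fin_numElt => /andP[].
Qed.

(** If a norm is infinite, so is the right-hand side. Otherwise both functions are almost everywhere
    finite and the inequality for real functions applies. *)
Lemma ge0_minkowski f g : measurable_fun setT f -> measurable_fun setT g ->
  (forall x, 0 <= f x) -> (forall x, 0 <= g x) ->
  'N[mu]_p%:E[f \+ g] <= 'N[mu]_p%:E[f] + 'N[mu]_p%:E[g].
Proof.
move=> mf mg f0 g0.
have [->|Nf] := eqVneq 'N[mu]_p%:E[f] +oo.
  by rewrite addye ?leey// -ltNye (lt_le_trans _ (Lnorm_ge0 _ _ _)).
have [->|Ng] := eqVneq 'N[mu]_p%:E[g] +oo.
  by rewrite addey ?leey// -ltNye (lt_le_trans _ (Lnorm_ge0 _ _ _)).
rewrite -ltey in Nf; rewrite -ltey in Ng.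
have ff := Lnorm_lty_ae_fin mf Nf; have gg := Lnorm_lty_ae_fin mg Ng.
have mff : measurable_fun setT (fine \o f) by exact: measurableT_comp.
have mgg : measurable_fun setT (fine \o g) by exact: measurableT_comp.
rewrite (ae_eq_Lnorm mf _ ff); last exact/measurable_EFinP.
rewrite (ae_eq_Lnorm mg _ gg); last exact/measurable_EFinP.
apply: le_trans (minkowski_EFin mu mff mgg p1).
rewrite (@ae_eq_Lnorm _ (EFin \o ((fine \o f) \+ (fine \o g))%R))//.
- exact: emeasurable_funD.
- by apply/measurable_EFinP; exact: measurable_funD.
- by apply: filterS2 ff gg => x /= fx gx _; rewrite fx// gx.
Qed.

Lemma ge0_minkowski_sum (F : nat -> T -> \bar R) n :
  (forall k, measurable_fun setT (F k)) -> (forall k x, 0 <= F k x) ->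
  'N[mu]_p%:E[(fun x => \sum_(0 <= k < n) F k x)] <=
  \sum_(0 <= k < n) 'N[mu]_p%:E[F k].
Proof.
move=> mF F0; elim: n => [|n ih].
  under eq_Lnorm do rewrite big_geq//.
  by rewrite big_geq// Lnorm0// eqe.
rewrite big_nat_recr//=.
under eq_Lnorm do rewrite big_nat_recr//=.
apply: le_trans (leeD2r _ ih).
apply: ge0_minkowski => //.
- by apply: emeasurable_sum.
- by move=> x; exact: sume_ge0.
Qed.

(** Continuity of the power along nondecreasing partial sums, the value [+oo] included: both
    inequalities follow from monotonicity of the power and of its inverse. *)
Lemma poweR_nneseries (u : nat -> \bar R) : (forall k, 0 <= u k) ->
  (\sum_(k <oo) u k) `^ p = limn (fun n => (\sum_(0 <= k < n) u k) `^ p).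
Proof.
move=> u0; set L := RHS.
have s0 n : 0 <= \sum_(0 <= k < n) u k by exact: sume_ge0.
have nd : nondecreasing_seq (fun n => (\sum_(0 <= k < n) u k) `^ p).
  move=> m n mn; apply: ge0_le_poweR => //; first exact: ltW.
  exact: lee_sum_nneg_natr.
have cv := ereal_nondecreasing_is_cvgn nd.
have leL n : (\sum_(0 <= k < n) u k) `^ p <= L.
  by apply: (lime_ge cv); exists n => // m /= nm; exact: nd.
have L0 : 0 <= L by apply: le_trans (leL 0%N); exact: poweR_ge0.
apply/eqP; rewrite eq_le; apply/andP; split.
  rewrite -[leRHS](poweRVK pN0 L0); apply: ge0_le_poweR; first exact: ltW.
    exact: nneseries_ge0.
  apply: lime_le; first exact: is_cvg_nneseries.
  apply: nearW => n; rewrite -[leLHS](poweRK pN0 (s0 n)).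
  by apply: ge0_le_poweR => //; rewrite ?invr_ge0 ?poweR_ge0// ltW.
apply: lime_le => //; apply: nearW => n.
apply: ge0_le_poweR => //; first exact: ltW.
exact: nneseries_lim_ge.
Qed.

(** Monotone convergence applied to the [p]-th powers of the partial sums carries the finite
    inequality to the limit. *)
Lemma ge0_minkowski_series (F : nat -> T -> \bar R) :
  (forall k, measurable_fun setT (F k)) -> (forall k x, 0 <= F k x) ->
  'N[mu]_p%:E[(fun x => \sum_(0 <= k <oo) F k x)] <=
  \sum_(0 <= k <oo) 'N[mu]_p%:E[F k].
Proof.
move=> mF F0; set C := \sum_(0 <= k <oo) _.
have C0 : 0 <= C by apply: nneseries_ge0 => *; exact: Lnorm_ge0.
rewrite LnormE -[leRHS](poweRK pN0 C0); apply: ge0_le_poweR.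
- by rewrite invr_ge0 ltW.
- by apply: integral_ge0 => x _; exact: poweR_ge0.
under eq_integral => x _.
  rewrite gee0_abs; last exact: nneseries_ge0.
  rewrite poweR_nneseries//.
  over.
have nd x : nondecreasing_seq (fun n => (\sum_(0 <= k < n) F k x) `^ p).
  move=> m n mn; apply: ge0_le_poweR => //; first exact: ltW.
    exact: sume_ge0.
  exact: lee_sum_nneg_natr.
have mS n : measurable_fun setT (fun x => \sum_(0 <= k < n) F k x).
  exact: emeasurable_sum.
have mSp n : measurable_fun setT (fun x => (\sum_(0 <= k < n) F k x) `^ p).
  by apply: (measurableT_comp (measurable_poweR p)).
rewrite monotone_convergence//; last first.
  by move=> n x _; exact: poweR_ge0.
apply: lime_le.
  apply: ereal_nondecreasing_is_cvgn => m n mn.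
  apply: ge0_le_integral => //.
  - by move=> x _; exact: poweR_ge0.
  - by move=> x _; exact: nd.
apply: nearW => n.
have -> : \int[mu]_x (\sum_(0 <= k < n) F k x) `^ p =
    'N[mu]_p%:E[(fun x => \sum_(0 <= k < n) F k x)] `^ p.
  rewrite poweR_Lnorm//; apply: eq_integral => x _.
  by rewrite gee0_abs//; exact: sume_ge0.
apply: ge0_le_poweR; [exact: ltW|exact: Lnorm_ge0|].
apply: le_trans (ge0_minkowski_sum n mF F0) _.
by apply: nneseries_lim_ge => *; exact: Lnorm_ge0.
Qed.

End Lnorm_ereal.

(** * Comparison of norms on a probability space *)

Section probability_Lnorm.
Context {R : realType} {d : measure_display} {T : measurableType d}.
Variable mu : probability T R.
Variable p : R.
Hypothesis p1 : 1 <= p.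
Local Open Scope ereal_scope.

(** Hoelder against the constant 1, with [q] the conjugate exponent; for [p = 1] it would be
    infinite, hence the separate case. *)
Lemma Lnorm1_le_Lnorm (g : T -> R) : measurable_fun setT g ->
  \int[mu]_x `|(g x)%:E| <= 'N[mu]_p%:E[EFin \o g].
Proof.
move=> mg; have [p_eq1|pN1] := eqVneq p 1%R.
  by rewrite p_eq1 Lnorm1.
have lt1p : (1 < p)%R by rewrite lt_neqAle eq_sym pN1.
have p0 : (0 < p)%R by exact: lt_trans lt1p.
pose q := ((1 - p^-1)^-1)%R.
have q0 : (0 < q)%R by rewrite invr_gt0 subr_gt0 invf_lt1.
have := @hoelder _ _ _ mu g (cst 1%R) p q mg (measurable_cst _) p0 q0.
rewrite /q invrK subrKC => /(_ erefl).
rewrite (_ : (g \* cst 1)%R = g); last by apply/funext => x /=; rewrite mulr1.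
rewrite Lnorm1 => /le_trans; apply.
rewrite -/(@cst T (\bar R) 1%:E) (_ : EFin \o cst 1%R = cst 1)//.
rewrite Lnorm_cst1 [X in _ * X `^ _](_ : _ = 1); last exact: probability_setT.
by rewrite poweR_EFin powR1 mule1.
Qed.

End probability_Lnorm.

(** * Moment bounds for a single round *)

Section round_moments.
Context {R : realType} {d : measure_display} {T : measurableType d}.
Variables (P : probability T R) (U : nat -> {RV P >-> R}) (alpha : R).
Hypothesis hU : iid_uniform01 U.
Implicit Types (f : R -> R -> R) (k i n : nat) (w : T).
Local Notation u w := (fun i => U i w).
Local Notation unif := (uniform_prob (@ltr01 R)).
Local Open Scope ereal_scope.

(** The key cost vanishes off the open unit interval, so Lebesgue and uniform integrals agree. This
    exhibits [I_k] as the mean cost of a fresh key. *)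
Lemma limit_round_unif f (v : nat -> R) k :
  measurable_fun setT (fun z : R * R => f z.1 z.2) ->
  (forall x y, (0 <= f x y)%R) ->
  limit_round f alpha v k = \int[unif]_x (key_cost alpha f v k x)%:E.
Proof.
move=> mf f0; rewrite limit_roundE.
have mk : measurable_fun [set: R] (key_cost alpha f v k).
  (* A fixed sequence is a random one on the one-point space, so the joint measurability lemma
     yields this section. *)
  have mv j : measurable_fun [set: unit] (fun=> v j) by exact: measurable_cst.
  exact: (measurable_fun_pair2 tt (measurable_key_cost alpha mv mf k)).
rewrite (integral_uniform (@ltr01 R)); last 2 first.
- exact/measurable_EFinP.
- by move=> x; rewrite lee_fin key_cost_ge0.
rewrite subr0 invr1 mul1e [RHS]integral_mkcond; apply: eq_integral => x _.
rewrite patchE; case: ifPn => //; rewrite notin_setE/= in_itv/= => /negP x01.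
by rewrite key_cost_out//; apply: contra x01 => /andP[/ltW -> /ltW ->].
Qed.

Lemma limit_round_ge0 f (v : nat -> R) k : (forall x y, (0 <= f x y)%R) ->
  0 <= limit_round f alpha v k.
Proof.
by move=> f0; rewrite limit_roundE; apply: integral_ge0 => x _;
  rewrite lee_fin key_cost_ge0.
Qed.

Lemma limit_round_trunc f (v : nat -> R) n k :
  limit_round f alpha (trunc n v) k =
  if before (tau alpha v k) n then limit_round f alpha v k else 0.
Proof.
rewrite !limit_roundE; under eq_integral do rewrite key_cost_trunc.
case: ifPn => _; first by under eq_integral do rewrite mul1r.
by under eq_integral do rewrite mul0r; rewrite integral0.
Qed.

Section one_cost.
Variable f : R -> R -> R.
Hypothesis mf : measurable_fun setT (fun z : R * R => f z.1 z.2).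
Hypothesis f0 : forall x y, (0 <= f x y)%R.

Lemma measurable_trunc_past n j :
  measurable_fun [set: g_sigma_algebraType (past_cylinders U n)]
    (fun w => trunc n (u w) j).
Proof.
rewrite /trunc; case: (boolP (j < n)%N) => // jn.
exact: measurable_past.
Qed.

Lemma measurable_key_past n k : measurable_fun
  [set: g_sigma_algebraType (past_cylinders U n) * measurableTypeR R]
  (fun z => (key_cost alpha f (trunc n (u z.1)) k z.2)).
Proof.
exact: (measurable_key_cost (T := g_sigma_algebraType (past_cylinders U n))
  alpha (v := fun j w => trunc n (u w) j) (@measurable_trunc_past n) mf k).
Qed.

Lemma measurable_key n k :
  measurable_fun setT (fun w => key_cost alpha f (trunc n (u w)) k (U n w)).
Proof.
apply: (measurable_key_cost_comp alpha (v := fun j w => trunc n (u w) j)) => //.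
by move=> j; apply: (measurable_trunc (v := fun j w => U j w)).
Qed.

Lemma measurable_round_cost n k :
  measurable_fun setT (fun w => round_cost f alpha (u w) n k).
Proof.
under eq_fun do rewrite round_costE.
by apply: measurable_sum => i; exact: measurable_key.
Qed.

Lemma measurable_limit_round_seeds k :
  measurable_fun setT (fun w => limit_round f alpha (u w) k).
Proof.
exact: (measurable_limit_round alpha (v := fun j w => U j w)).
Qed.

Lemma expectation_key n k :
  \int[P]_w (key_cost alpha f (trunc n (u w)) k (U n w))%:E =
  \int[P]_w limit_round f alpha (trunc n (u w)) k.
Proof.
rewrite (ge0_integral_past_and_seed hU (n := n) (F := fun z =>
  (key_cost alpha f (trunc n (u z.1)) k z.2)%:E)); last 2 first.
- by apply/measurable_EFinP; exact: (@measurable_key_past n k).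
- by move=> z; rewrite lee_fin key_cost_ge0.
by apply: eq_integral => w _; rewrite limit_round_unif.
Qed.

(** Truncating the seeds either keeps [I_k] or replaces it by 0. *)
Lemma expectation_key_le n k :
  \int[P]_w (key_cost alpha f (trunc n (u w)) k (U n w))%:E <=
  \int[P]_w limit_round f alpha (u w) k.
Proof.
rewrite expectation_key; apply: ge0_le_integral => //.
- by move=> w _; exact: limit_round_ge0.
- apply: (measurable_limit_round alpha (v := fun j w => trunc n (u w) j)) => //.
  by move=> j; apply: (measurable_trunc (v := fun j w => U j w)).
- exact: measurable_limit_round_seeds.
- move=> w _; rewrite limit_round_trunc; case: ifPn => // _.
  exact: limit_round_ge0.
Qed.

End one_cost.

Section Lp_bounds.
Variables (f : R -> R -> R) (p : R).
Hypothesis p1 : (1 <= p)%R.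
Hypothesis mf : measurable_fun setT (fun z : R * R => f z.1 z.2).
Hypothesis f0 : forall x y, (0 <= f x y)%R.
Let p0 : (0 < p)%R. Proof. exact: lt_le_trans ltr01 p1. Qed.
Let pN0 : p != 0%R. Proof. by rewrite gt_eqF. Qed.

Let mfp : measurable_fun setT (fun z : R * R => (f z.1 z.2 `^ p)%R).
Proof. exact: (measurableT_comp (measurable_powR p)). Qed.

Definition round_Lp_bound k : \bar R :=
  (\int[P]_w limit_round_pow f alpha p (u w) k) `^ p^-1.

Lemma limit_round_powE (v : nat -> R) k : limit_round_pow f alpha p v k =
  limit_round (fun x y => f x y `^ p)%R alpha v k.
Proof. by []. Qed.

Lemma Lnorm_round_cost_le n k :
  'N[P]_p%:E[(fun w => (n%:R^-1 * round_cost f alpha (u w) n k)%:E)] <=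
  round_Lp_bound k.
Proof.
have mk i : measurable_fun setT (EFin \o
    (fun w => key_cost alpha f (trunc i (u w)) k (U i w))).
  exact/measurable_EFinP/measurable_key.
have k0 i w : 0 <= (EFin \o
    (fun w => key_cost alpha f (trunc i (u w)) k (U i w))) w.
  by rewrite lee_fin key_cost_ge0.
under eq_Lnorm => w do rewrite EFinM round_costE -(big_mkord xpredT
  (fun i => key_cost alpha f (trunc i (u w)) k (U i w))) -sumEFin.
rewrite ge0_LnormZ//; last by apply: emeasurable_sum.
have [->|n0] := posnP n; first by rewrite invr0 mul0e poweR_ge0.
apply: (@le_trans _ _ ((n%:R^-1)%:E * \sum_(0 <= i < n) round_Lp_bound k)).
  apply: lee_wpmul2l; first by rewrite lee_fin invr_ge0.
  apply: le_trans (ge0_minkowski_sum P p1 n mk k0) _.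
  apply: lee_sum => i _; rewrite LnormE; apply: ge0_le_poweR.
  - by rewrite invr_ge0 ltW.
  - by apply: integral_ge0 => w _; exact: poweR_ge0.
  (* The [p]-th power of the key cost is the key cost for [f ^ p], to which the bound on means
     applies. *)
  under eq_integral => w _ do
    rewrite (gee0_abs (k0 i w)) /= -key_cost_powR//.
  by apply: expectation_key_le => // x y; exact: powR_ge0.
have : 0 <= round_Lp_bound k by exact: poweR_ge0.
(* No finiteness of the bound is assumed here; the infinite case is trivial. *)
case: round_Lp_bound => [r _| _|//]; last by rewrite leey.
rewrite sumEFin -EFinM lee_fin sumr_const_nat subn0 -(mulr_natl r) mulrA mulVf.
  by rewrite mul1r.
by rewrite pnatr_eq0 -lt0n.
Qed.

(** Jensen for a uniform key, path by path, obtained from the comparison of the [L^1] and [L^p]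
    norms under the uniform law. *)
Lemma limit_round_powR_le (v : nat -> R) k :
  limit_round f alpha v k `^ p <= limit_round_pow f alpha p v k.
Proof.
have kp0 : 0 <= limit_round_pow f alpha p v k.
  by rewrite limit_round_powE; apply: limit_round_ge0 => x y; exact: powR_ge0.
rewrite -[leRHS](poweRVK pN0 kp0); apply: ge0_le_poweR; first exact: ltW.
  exact: limit_round_ge0.
have fp0 x y : (0 <= f x y `^ p)%R by exact: powR_ge0.
rewrite limit_round_powE !limit_round_unif//.
have mv j : measurable_fun [set: unit] (fun=> v j) by exact: measurable_cst.
have mk : measurable_fun [set: R] (key_cost alpha f v k).
  exact: (measurable_fun_pair2 tt (measurable_key_cost alpha mv mf k)).
have := @Lnorm1_le_Lnorm _ _ _ unif p p1 _ mk; rewrite LnormE.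
have absk x : `|(key_cost alpha f v k x)%:E| = (key_cost alpha f v k x)%:E.
  by rewrite gee0_abs// lee_fin key_cost_ge0.
under eq_integral do rewrite absk.
under [X in X <= _ -> _]eq_integral do rewrite absk.
move=> /le_trans; apply; rewrite le_eqVlt; apply/predU1P; left.
congr (_ `^ _); apply: eq_integral => x _.
by rewrite /= key_cost_powR// poweR_EFin.
Qed.

Lemma Lnorm_limit_round_le k :
  'N[P]_p%:E[(fun w => limit_round f alpha (u w) k)] <= round_Lp_bound k.
Proof.
rewrite LnormE; apply: ge0_le_poweR.
- by rewrite invr_ge0 ltW.
- by apply: integral_ge0 => w _; exact: poweR_ge0.
apply: ge0_le_integral => //.
- by move=> w _; exact: poweR_ge0.
- exact/measurable_abse_poweR/measurable_limit_round_seeds.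
- rewrite (_ : (fun w => _) = fun w =>
    limit_round (fun x y => f x y `^ p)%R alpha (u w) k)//.
  by apply: measurable_limit_round_seeds => // x y; exact: powR_ge0.
- move=> w _; rewrite gee0_abs ?limit_round_ge0//.
  exact: limit_round_powR_le.
Qed.

End Lp_bounds.
End round_moments.

Lemma ge0_cvge0P {R : realType} (a : nat -> \bar R) : (forall n, (0 <= a n)%E) ->
  a @ \oo --> 0%E <->
  forall e : R, 0 < e -> \forall n \near \oo, (a n <= e%:E)%E.
Proof.
move=> a0; split=> [/fine_cvgP[afin /cvgrPdist_le ae] e e0|ae].
  near=> n; have fn : a n \is a fin_num by near: n; exact: afin.
  rewrite -(fineK fn) lee_fin; have : `|0 - (fine \o a) n| <= e.
    by near: n; exact: ae.
  by rewrite sub0r normrN /= ger0_norm// fine_ge0.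
have afin e : (a e <= 1%:E)%E -> a e \is a fin_num.
  by move=> ale; rewrite ge0_fin_numE// (le_lt_trans ale)// ltry.
apply/fine_cvgP; split.
  by apply: filterS (ae 1 ltr01) => n; exact: afin.
apply/cvgrPdist_le => e e0; near=> n.
have fn : a n \is a fin_num by apply: afin; near: n; exact: ae.
rewrite sub0r normrN /= ger0_norm ?fine_ge0// -lee_fin fineK//.
by near: n; exact: ae.
Unshelve. all: by end_near.
Qed.

(** * From second moments to [p]-norms for bounded variables *)

Section bounded_random_variables.
Context {R : realType} {d : measure_display} {T : measurableType d}.
Variable mu : probability T R.
Local Open Scope ereal_scope.

Lemma integrable_bounded (g : T -> R) (B : R) : measurable_fun setT g ->
  (forall x, (`|g x| <= B)%R) -> mu.-integrable setT (EFin \o g).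
Proof.
move=> mg gB; apply: measurable_bounded_integrable => //.
  by rewrite (le_lt_trans (probability_le1 _ _)) ?ltry.
exists B; split; first exact: num_real.
by move=> y By x _; exact: le_trans (gB x) (ltW By).
Qed.

Lemma integral_cst_probability (B : R) : \int[mu]_x B%:E = B%:E.
Proof.
rewrite integral_cst// [X in _ * X](_ : _ = 1) ?mule1//.
exact: probability_setT.
Qed.

Lemma ge0_integral_le_cst (g : T -> \bar R) (B : R) : measurable_fun setT g ->
  (forall x, 0 <= g x) -> (forall x, g x <= B%:E) -> \int[mu]_x g x <= B%:E.
Proof.
move=> mg g0 gB; rewrite -(integral_cst_probability B).
apply: ge0_le_integral => //.
Qed.

(* With [delta := e^p / (2 M^(p-1))], from
   [|Y|^p <= M^(p-1) |Y| <= M^(p-1) (delta + Y^2 / delta)]. *)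
Lemma bounded_Lnorm_le (p M e : R) : (1 <= p)%R -> (0 < M)%R -> (0 < e)%R ->
  exists2 eta : R, (0 < eta)%R & forall Y : T -> R, measurable_fun setT Y ->
    (forall x, (`|Y x| <= M)%R) -> \int[mu]_x ((Y x ^+ 2)%:E) <= eta%:E ->
    'N[mu]_p%:E[EFin \o Y] <= e%:E.
Proof.
move=> p1 M0 e0; have p0 : (0 < p)%R by exact: lt_le_trans ltr01 p1.
pose K := (M `^ (p - 1))%R; have K0 : (0 < K)%R by exact: powR_gt0.
pose delta := (e `^ p / (2 * K))%R.
have d0 : (0 < delta)%R by rewrite divr_gt0 ?powR_gt0 ?mulr_gt0.
exists (delta ^+ 2)%R; first by rewrite exprn_gt0.
move=> Y mY YM Y2.
have Yp x : (`|Y x| `^ p <= K * delta + K / delta * Y x ^+ 2)%R.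
  apply: (@le_trans _ _ (K * `|Y x|)%R).
    rewrite mulrC -(mulr_powRB1 (normr_ge0 _) p0) ler_wpM2l//.
    by rewrite ge0_ler_powR ?subr_ge0// ?nnegrE// ltW.
  rewrite -[leRHS](_ : (K * (delta + Y x ^+ 2 / delta))%R = _); last first.
    by move: (delta) d0 => D D0; field; rewrite gt_eqF.
  rewrite ler_pM2l// -[in leRHS](real_normK (num_real (Y x))).
  have := sqr_ge0 (`|Y x| - delta)%R; set y := `|Y x|%R => y2.
  have y0 : (0 <= y)%R by exact: normr_ge0.
  rewrite -(ler_pM2r d0) mulrDl divfK ?gt_eqF//.
  have : (0 <= y * delta)%R by rewrite mulr_ge0// ltW.
  by move: y2; rewrite !expr2; nra.
have mY2 : measurable_fun setT (fun x => (Y x ^+ 2)%:E).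
  by apply/measurable_EFinP; exact: measurable_funX.
have Kd : (0 <= K / delta)%R by rewrite ltW// divr_gt0.
have e_ge0 : 0 <= e%:E by rewrite lee_fin ltW.
rewrite LnormE -[leRHS](@poweRK _ _ p) ?gt_eqF//.
apply: ge0_le_poweR.
- by rewrite invr_ge0 ltW.
- by apply: integral_ge0 => x _; exact: poweR_ge0.
apply: (@le_trans _ _ (\int[mu]_x
    ((K * delta)%:E + (K / delta)%:E * (Y x ^+ 2)%:E))).
  apply: ge0_le_integral => //.
  - by move=> x _; exact: poweR_ge0.
  - by apply: measurable_abse_poweR; exact/measurable_EFinP.
  - apply: emeasurable_funD => //; exact: measurable_funeM.
  - by move=> x _ /=; rewrite -EFinM -EFinD lee_fin.
have c0 : 0 <= (K * delta)%:E by rewrite lee_fin mulr_ge0// ltW.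
have q0 x : 0 <= (K / delta)%:E * (Y x ^+ 2)%:E.
  by rewrite -EFinM lee_fin mulr_ge0// sqr_ge0.
have mq : measurable_fun setT (fun x => (K / delta)%:E * (Y x ^+ 2)%:E).
  exact: measurable_funeM.
rewrite ge0_integralD//.
rewrite integral_cst_probability ge0_integralZl_EFin//; last first.
  by move=> x _; rewrite lee_fin sqr_ge0.
apply: (@le_trans _ _ ((K * delta)%:E + (K / delta)%:E * (delta ^+ 2)%:E)).
  by apply: leeD2l; apply: lee_wpmul2l.
rewrite -EFinM -EFinD poweR_EFin lee_fin /delta.
rewrite le_eqVlt; apply/predU1P; left.
have : (e `^ p != 0)%R by rewrite gt_eqF// powR_gt0.
by move: (e `^ p)%R => E E0; field; rewrite E0 gt_eqF.
Qed.

End bounded_random_variables.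

(** * One round with a bounded cost *)

Section bounded_round.
Context {R : realType} {d : measure_display} {T : measurableType d}.
Variables (P : probability T R) (U : nat -> {RV P >-> R}) (alpha : R).
Hypothesis hU : iid_uniform01 U.
Variables (f : R -> R -> R) (M : R) (k : nat).
Hypothesis mf : measurable_fun setT (fun z : R * R => f z.1 z.2).
Hypothesis f0 : forall x y, 0 <= f x y.
Hypothesis M0 : 0 < M.
Hypothesis fM : forall x y, f x y <= M.
Implicit Types (i n : nat) (w : T) (v : nat -> R).
Local Notation u w := (fun i => U i w).
Local Notation unif := (uniform_prob (@ltr01 R)).
Local Notation past n := (g_sigma_algebraType (past_cylinders U n)).

Let M_ge0 : 0 <= M. Proof. exact: ltW. Qed.

(** With random seeds, [mean i] is the conditional mean of [key i] given the first [i] seeds. The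
    differences are martingale increments and [centered_sum] is the martingale. *)
Let key i v := key_cost alpha f (trunc i v) k (v i).
Let mean i v := fine (limit_round f alpha (trunc i v) k).

Lemma measurable_key_cost_section v :
  measurable_fun [set: R] (key_cost alpha f v k).
Proof.
have mv j : measurable_fun [set: unit] (fun=> v j) by exact: measurable_cst.
exact: (measurable_fun_pair2 tt (measurable_key_cost alpha mv mf k)).
Qed.

Lemma key_cost_norm_le v x : `|key_cost alpha f v k x| <= M.
Proof. by rewrite ger0_norm ?key_cost_ge0// key_cost_le// ltW. Qed.

Lemma limit_round_le v : (limit_round f alpha v k <= M%:E)%E.
Proof.
rewrite limit_round_unif//; apply: ge0_integral_le_cst.
- by apply/measurable_EFinP; exact: measurable_key_cost_section.
- by move=> x; rewrite lee_fin key_cost_ge0.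
- by move=> x; rewrite lee_fin key_cost_le// ltW.
Qed.

Lemma limit_round_fineK v :
  (fine (limit_round f alpha v k))%:E = limit_round f alpha v k.
Proof.
rewrite fineK// ge0_fin_numE ?limit_round_ge0//.
by rewrite (le_lt_trans (limit_round_le v)) ?ltry.
Qed.

Lemma fine_limit_round_ge0 v : 0 <= fine (limit_round f alpha v k).
Proof. by rewrite fine_ge0 ?limit_round_ge0. Qed.

Lemma fine_limit_round_le v : fine (limit_round f alpha v k) <= M.
Proof. by rewrite -lee_fin limit_round_fineK limit_round_le. Qed.

Definition centered_sum n v : R := \sum_(i < n) (key i v - mean i v).

Lemma centered_norm_le i v : `|key i v - mean i v| <= M.
Proof.
have k0 : 0 <= key i v by exact: key_cost_ge0.
have kM : key i v <= M by apply: key_cost_le => //; exact: ltW.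
have m0 : 0 <= mean i v by exact: fine_limit_round_ge0.
have mM : mean i v <= M by exact: fine_limit_round_le.
by rewrite ler_norml; apply/andP; split; lra.
Qed.

Lemma centered_sum_norm_le n v : `|centered_sum n v| <= n%:R * M.
Proof.
rewrite /centered_sum; apply: (le_trans (ler_norm_sum _ _ _)).
rewrite mulr_natl -[X in _ *+ X](card_ord n) -sumr_const.
by apply: ler_sum => i _; exact: centered_norm_le.
Qed.

(** Adaptedness: the martingale at time [n] is a function of the first [n] seeds. *)
Lemma centered_sum_trunc n v : centered_sum n (trunc n v) = centered_sum n v.
Proof.
apply: eq_bigr => i _; rewrite /key /mean trunc_trunc 1?ltnW//.
by rewrite {2}/trunc ltn_ord.
Qed.

Section measurability.
Context {d' : measure_display} {T' : measurableType d'} (v : nat -> T' -> R).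
Hypothesis mv : forall j, measurable_fun [set: T'] (v j).

Lemma measurable_mean i : measurable_fun setT (fun t => mean i (v^~ t)).
Proof.
apply: measurableT_comp => //.
apply: (measurable_limit_round alpha (v := fun j t => trunc i (v^~ t) j)) => //.
by move=> j; exact: measurable_trunc.
Qed.

Lemma measurable_centered_sum n :
  measurable_fun setT (fun t => centered_sum n (v^~ t)).
Proof.
apply: measurable_sum => i; apply: measurable_funB; last exact: measurable_mean.
apply: (measurable_key_cost_comp alpha (v := fun j t => trunc i (v^~ t) j)) => //.
by move=> j; exact: measurable_trunc.
Qed.
End measurability.

Let mU j : measurable_fun [set: T] (fun w => U j w).
Proof. exact: measurable_funP. Qed.

Lemma centered_orthogonal n :
  (\int[P]_w (centered_sum n (u w) * (key n (u w) - mean n (u w)))%:E = 0)%E.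
Proof.
(* The integrand as a function of past and new seed. Everything taken from the past is computed from
   truncated seeds, hence is measurable on [past n]. *)
pose F (z : past n * measurableTypeR R) : \bar R :=
  (centered_sum n (trunc n (u z.1)) *
   (key_cost alpha f (trunc n (u z.1)) k z.2 - mean n (u z.1)))%:E.
have tp : forall j, measurable_fun [set: past n] (fun w => trunc n (u w) j).
  by move=> j; exact: measurable_trunc_past.
have mean_trunc w : mean n (u w) = mean n (trunc n (u w)).
  by rewrite /mean trunc_trunc.
have mW :
    measurable_fun [set: past n] (fun w => centered_sum n (trunc n (u w))).
  exact: (measurable_centered_sum (T' := past n)
    (v := fun j w => trunc n (u w) j)).
have mm : measurable_fun [set: past n] (fun w => mean n (u w)).
  under eq_fun do rewrite mean_trunc.
  exact: (measurable_mean (T' := past n) (v := fun j w => trunc n (u w) j)).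
have mfst : measurable_fun [set: past n * measurableTypeR R] fst.
  exact: measurable_fst.
have mF : measurable_fun setT F.
  apply/measurable_EFinP; apply: measurable_funM.
    exact: (measurableT_comp mW mfst).
  apply: measurable_funB; first exact: (@measurable_key_past _ _ _ _ U).
  exact: (measurableT_comp mm mfst).
pose C : R := n%:R * M * M.
have boundF z : (`|F z| <= C%:E)%E.
  rewrite lee_fin normrM; apply: ler_pM => //.
    exact: centered_sum_norm_le.
  have k0 : 0 <= key_cost alpha f (trunc n (u z.1)) k z.2.
    exact: key_cost_ge0.
  have kM : key_cost alpha f (trunc n (u z.1)) k z.2 <= M.
    by apply: key_cost_le => //; exact: ltW.
  have m0 : 0 <= mean n (u z.1) by exact: fine_limit_round_ge0.
  have mM : mean n (u z.1) <= M by exact: fine_limit_round_le.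
  by rewrite ler_norml; apply/andP; split; lra.
have maF : measurable_fun setT (abse \o F) by exact: measurableT_comp.
have mG : measurable_fun [set: past n] (fun w => \int[unif]_x `|F (w, x)|)%E.
  apply: (@measurable_fun_fubini_tonelli_F _ _ _ _ _ unif (abse \o F)) => // z.
  exact: abse_ge0.
transitivity (\int[P]_w F (w, U n w))%E.
  by apply: eq_integral => w _; rewrite /F /= centered_sum_trunc.
rewrite (integral_past_and_seed hU mF); last first.
  apply: (@le_lt_trans _ _ C%:E); last by rewrite ltry.
  apply: ge0_integral_le_cst => [||w].
  - exact: (measurableT_comp mG (@measurable_to_past _ _ _ _ U n)).
  - by move=> w; apply: integral_ge0.
  - apply: ge0_integral_le_cst => //.
    exact: (measurable_fun_pair2 (w : past n) maF).
(* With the past frozen, the first factor is constant and the second is a key cost minus its own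
   mean. *)
apply: integral0_eq => w _.
pose K := key_cost alpha f (trunc n (u w)) k.
have iK : unif.-integrable setT (EFin \o K).
  apply: (@integrable_bounded _ _ _ unif _ M) => [|x].
    exact: measurable_key_cost_section.
  exact: key_cost_norm_le.
have im : unif.-integrable setT (EFin \o cst (mean n (u w))).
  by apply: (@integrable_bounded _ _ _ unif _ `|mean n (u w)|).
transitivity (\int[unif]_x ((centered_sum n (trunc n (u w)))%:E *
    ((EFin \o K) x - (EFin \o cst (mean n (u w))) x)))%E.
  by apply: eq_integral => x _; rewrite /F /= EFinM EFinB.
rewrite integralZl//; last exact: integrableB.
rewrite integralB// -[X in (X - _)%E]/(\int[unif]_x (K x)%:E)%E.
rewrite -limit_round_unif// integral_cst_probability.
by rewrite /mean limit_round_fineK subee ?mule0// -limit_round_fineK.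
Qed.

Let mW n : measurable_fun setT (fun w => centered_sum n (u w)).
Proof. exact: (measurable_centered_sum (v := fun j w => U j w)). Qed.

Let mkey n : measurable_fun setT (fun w => key n (u w)).
Proof. exact: measurable_key. Qed.

Let mmean n : measurable_fun setT (fun w => mean n (u w)).
Proof. exact: (measurable_mean (v := fun j w => U j w)). Qed.

Let mdiff n : measurable_fun setT (fun w => key n (u w) - mean n (u w)).
Proof. exact: measurable_funB. Qed.

Lemma second_moment n :
  (\int[P]_w (centered_sum n (u w) ^+ 2)%:E <= (n%:R * M ^+ 2)%:E)%E.
Proof.
elim: n => [|n ih].
  under eq_integral do rewrite /centered_sum big_ord0 expr0n/=.
  by rewrite integral0 mul0r.
pose W w := centered_sum n (u w); pose D w := key n (u w) - mean n (u w).
(* These crude bounds serve integrability only, so that the integral of the expanded square can be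
   split; orthogonality then removes the cross term. *)
have iW2 : P.-integrable setT (EFin \o (fun w => W w ^+ 2)).
  apply: (@integrable_bounded _ _ _ P _ ((n%:R * M) ^+ 2)).
    exact: (measurable_funX 2 (mW n)).
  move=> w; rewrite normrX ler_sqr ?nnegrE ?mulr_ge0//.
  exact: centered_sum_norm_le.
have iD2 : P.-integrable setT (EFin \o (fun w => D w ^+ 2)).
  apply: (@integrable_bounded _ _ _ P _ (M ^+ 2)).
    exact: (measurable_funX 2 (mdiff n)).
  move=> w; rewrite normrX ler_sqr ?nnegrE//.
  exact: centered_norm_le.
have iWD : P.-integrable setT (EFin \o (fun w => W w * D w)).
  apply: (@integrable_bounded _ _ _ P _ (n%:R * M * M)).
    exact: (measurable_funM (mW n) (mdiff n)).
  move=> w; rewrite normrM; apply: ler_pM => //.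
    exact: centered_sum_norm_le.
  exact: centered_norm_le.
pose W2 w := W w ^+ 2; pose D2 w := D w ^+ 2; pose WD w := W w * D w.
have -> : (\int[P]_w (centered_sum n.+1 (u w) ^+ 2)%:E =
  \int[P]_w (((EFin \o W2) w + (EFin \o D2) w) + 2%:E * (EFin \o WD) w))%E.
  apply: eq_integral => w _; rewrite /= -EFinM -!EFinD /centered_sum.
  rewrite big_ord_recr/= -/(centered_sum n (u w)) -/(W w) -/(D w) /W2 /D2 /WD.
  by congr EFin; ring.
rewrite integralD//; last 2 first.
- exact: integrableD.
- exact: integrableZl.
rewrite integralZl// [X in (_ + 2%:E * X)%E]centered_orthogonal mule0 adde0.
rewrite integralD// -natr1 mulrDl mul1r EFinD; apply: leeD => //.
apply: ge0_integral_le_cst => [|w|w].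
- by apply/measurable_EFinP; exact: (measurable_funX 2 (mdiff n)).
- by rewrite lee_fin sqr_ge0.
- rewrite lee_fin /D2 -(real_normK (num_real (D w))) ler_sqr ?nnegrE//.
  exact: centered_norm_le.
Qed.

Lemma mean_cvg v :
  arithmetic_mean (fun i => mean i v) @ \oo --> fine (limit_round f alpha v k).
Proof.
apply: cesaro; apply: cvg_near_cst.
case E : (tau alpha v k) => [t|]; last first.
  apply: nearW => i; rewrite /mean limit_round_trunc E /=.
  by rewrite /limit_round E.
by exists t.+1 => // i /= ti; rewrite /mean limit_round_trunc E /= ti.
Qed.

Let Cbar n w : R := n.+1%:R^-1 * \sum_(i < n.+1) mean i (u w).
Let I w : R := fine (limit_round f alpha (u w) k).

Let Cbar_bound n w : `|Cbar n w - I w| <= M.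
Proof.
have I0 : 0 <= I w by exact: fine_limit_round_ge0.
have IM : I w <= M by exact: fine_limit_round_le.
have C0 : 0 <= Cbar n w.
  rewrite mulr_ge0 ?invr_ge0// sumr_ge0// => i _; exact: fine_limit_round_ge0.
have CM : Cbar n w <= M.
  rewrite /Cbar mulrC ler_pdivrMr ?ltr0n// mulr_natr.
  rewrite -[X in _ *+ X](card_ord n.+1) -sumr_const ler_sum// => i _.
  exact: fine_limit_round_le.
by rewrite ler_norml; apply/andP; split; lra.
Qed.

Let mI : measurable_fun setT I.
Proof.
by apply: measurableT_comp => //; exact: measurable_limit_round_seeds.
Qed.

Let mCbar n : measurable_fun setT (Cbar n).
Proof. by apply: measurable_funM => //; exact: measurable_sum. Qed.

(** The Cesaro means converge along each path, at a speed that depends on [tau]; dominated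
    convergence under [M ^ 2] avoids any rate. *)
Let drift_cvg0 : (\int[P]_w ((Cbar n w - I w) ^+ 2)%:E @[n --> \oo] --> 0)%E.
Proof.
have [|||||_ _] := @dominated_convergence _ _ _ P setT measurableT
  (fun n w => ((Cbar n w - I w) ^+ 2)%:E) (cst 0%E) (cst (M ^+ 2)%:E).
- move=> n; apply/measurable_EFinP; apply: measurable_funX.
  exact: measurable_funB.
- exact: measurable_cst.
- apply: aeW => w _; apply: cvg_EFin; first exact: nearW.
  have h : (fun n => Cbar n w - I w) @ \oo --> 0.
    rewrite -(subrr (I w)); apply: cvgB; last exact: cvg_cst.
    have := @mean_cvg (u w); rewrite /arithmetic_mean /series /=.
    by under eq_cvg do rewrite big_mkord.
  have hh := cvgM h h; rewrite mulr0 in hh; exact: hh.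
- by apply: (@integrable_bounded _ _ _ P (cst (M ^+ 2)) `|M ^+ 2|).
- apply: aeW => w n _ /=; rewrite lee_fin normrX ler_sqr ?nnegrE// ?ltW//.
by rewrite integral0.
Qed.

Lemma bounded_round_cvg (p : R) : 1 <= p ->
  ('N[P]_p%:E[(fun w => (n%:R^-1 * round_cost f alpha (u w) n k)%:E -
      limit_round f alpha (u w) k)] @[n --> \oo] --> 0)%E.
Proof.
(* The shift to [n.+1] keeps the divisor nonzero. *)
move=> p1; rewrite -cvg_shiftS /=.
pose Y n w := n.+1%:R^-1 * round_cost f alpha (u w) n.+1 k - I w.
have YE n : ('N[P]_p%:E[(fun w =>
      (n.+1%:R^-1 * round_cost f alpha (u w) n.+1 k)%:E -
      limit_round f alpha (u w) k)] = 'N[P]_p%:E[EFin \o Y n])%E.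
  by apply: eq_Lnorm => w; rewrite -limit_round_fineK.
under eq_cvg do rewrite YE.
(* Martingale part plus drift. *)
have Ysplit n w :
    Y n w = n.+1%:R^-1 * centered_sum n.+1 (u w) + (Cbar n w - I w).
  by rewrite /Y /Cbar round_costE /centered_sum sumrB; ring.
have mY n : measurable_fun setT (Y n).
  apply: measurable_funB => //; apply: measurable_funM => //.
  exact: measurable_round_cost.
have YM n w : `|Y n w| <= M.
  have I0 : 0 <= I w by exact: fine_limit_round_ge0.
  have IM : I w <= M by exact: fine_limit_round_le.
  have S0 : 0 <= n.+1%:R^-1 * round_cost f alpha (u w) n.+1 k.
    rewrite round_costE mulr_ge0 ?invr_ge0// sumr_ge0// => i _.
    exact: key_cost_ge0.
  have SM : n.+1%:R^-1 * round_cost f alpha (u w) n.+1 k <= M.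
    rewrite round_costE mulrC ler_pdivrMr ?ltr0n// mulr_natr.
    rewrite -[X in _ *+ X](card_ord n.+1) -sumr_const ler_sum// => i _.
    exact: key_cost_le.
  rewrite /Y; move: I0 IM S0 SM; move: (I w) (_ * _) => a b *.
  by rewrite ler_norml; apply/andP; split; lra.
(* The square of a sum is at most twice the sum of the squares. With [N = n.+1], the martingale part
   contributes [2 / N ^ 2] times the second moment bound [N M ^ 2]. *)
have Y2 n : (\int[P]_w (Y n w ^+ 2)%:E <= (2 * M ^+ 2 / n.+1%:R)%:E +
    2%:E * \int[P]_w ((Cbar n w - I w) ^+ 2)%:E)%E.
  pose A w := (2 / n.+1%:R ^+ 2) * centered_sum n.+1 (u w) ^+ 2.
  pose B w := 2 * (Cbar n w - I w) ^+ 2.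
  have n0 : (n.+1%:R : R) != 0 by rewrite pnatr_eq0.
  have mC2 : measurable_fun setT (fun w => ((Cbar n w - I w) ^+ 2)%:E).
    by apply/measurable_EFinP; apply: measurable_funX; exact: measurable_funB.
  have mA : measurable_fun setT (fun w => (A w)%:E).
    apply/measurable_EFinP; apply: measurable_funM => //.
    exact: (measurable_funX 2 (mW n.+1)).
  have A0 w : (0 <= (A w)%:E)%E.
    by rewrite lee_fin; apply: mulr_ge0; rewrite ?sqr_ge0// divr_ge0// exprn_ge0.
  have B0 w : (0 <= (B w)%:E)%E.
    by rewrite lee_fin; apply: mulr_ge0; rewrite ?sqr_ge0.
  have mB : measurable_fun setT (fun w => (B w)%:E).
    by under eq_fun do rewrite EFinM; exact: measurable_funeM.
  apply: (@le_trans _ _ (\int[P]_w ((A w)%:E + (B w)%:E))%E).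
    apply: ge0_le_integral => //.
    - by move=> w _; rewrite lee_fin sqr_ge0.
    - by apply/measurable_EFinP; exact: (measurable_funX 2 (mY n)).
    - exact: emeasurable_funD.
    - move=> w _; rewrite -EFinD lee_fin Ysplit /A /B.
      rewrite -mulrA (mulrC (n.+1%:R ^+ 2)^-1) -expr_div_n mulrC.
      move: (_ / _) (_ - _) => a b; have := sqr_ge0 (a - b).
      by rewrite !expr2; lra.
  rewrite ge0_integralD//; apply: leeD.
    rewrite /A; under eq_integral do rewrite EFinM.
    have mW2 : measurable_fun setT (fun w => (centered_sum n.+1 (u w) ^+ 2)%:E).
      by apply/measurable_EFinP; exact: (measurable_funX 2 (mW n.+1)).
    have c0 : 0 <= 2 / n.+1%:R ^+ 2 :> R by rewrite divr_ge0// exprn_ge0.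
    rewrite ge0_integralZl_EFin//; last by move=> w _; rewrite lee_fin sqr_ge0.
    apply: (le_trans (lee_wpmul2l _ (second_moment n.+1))).
      by rewrite lee_fin divr_ge0 ?exprn_ge0.
    rewrite -EFinM lee_fin le_eqVlt; apply/predU1P; left.
    by move: n0; move: (n.+1%:R : R) => N n0; field.
  rewrite /B; under eq_integral do rewrite EFinM.
  rewrite ge0_integralZl_EFin// => w _.
  by rewrite lee_fin sqr_ge0.
have Y2cvg : (\int[P]_w (Y n w ^+ 2)%:E @[n --> \oo] --> 0)%E.
  apply: (@squeeze_cvge _ _ _ _ (cst 0%E) _ (fun n =>
    (2 * M ^+ 2 / n.+1%:R)%:E + 2%:E * \int[P]_w ((Cbar n w - I w) ^+ 2)%:E)%E).
  - apply: nearW => n; rewrite Y2 andbT.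
    by apply: integral_ge0 => w _; rewrite lee_fin sqr_ge0.
  - exact: cvg_cst.
  - rewrite -[X in _ --> X]adde0; apply: cvgeD => //.
      apply: cvg_EFin; first exact: nearW.
      rewrite -(mulr0 (2 * M ^+ 2)); apply: cvgM; first exact: cvg_cst.
      exact: cvg_harmonic.
    by rewrite -[X in _ --> X](mule0 2%:E); exact: cvgeZl.
apply/ge0_cvge0P => [n|e e0]; first exact: Lnorm_ge0.
have [eta eta0 etaP] := bounded_Lnorm_le P p1 M0 e0.
have Y2_ge0 n : (0 <= \int[P]_w (Y n w ^+ 2)%:E)%E.
  by apply: integral_ge0 => w _; rewrite lee_fin sqr_ge0.
apply: filterS ((ge0_cvge0P Y2_ge0).1 Y2cvg eta eta0) => n Yn.
exact: etaP.
Qed.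

End bounded_round.

(** * One round with a general cost, by truncation *)

Section round_convergence.
Context {R : realType} {d : measure_display} {T : measurableType d}.
Variables (P : probability T R) (U : nat -> {RV P >-> R}) (alpha : R).
Hypothesis hU : iid_uniform01 U.
Variables (f : R -> R -> R) (p : R) (k : nat).
Hypothesis mf : measurable_fun setT (fun z : R * R => f z.1 z.2).
Hypothesis f0 : forall x y, 0 <= f x y.
Hypothesis p1 : 1 <= p.
Implicit Types (i n : nat) (w : T) (v : nat -> R).
Local Notation u w := (fun i => U i w).
Local Notation unif := (uniform_prob (@ltr01 R)).
Let p0 : 0 < p. Proof. exact: lt_le_trans ltr01 p1. Qed.
Let pN0 : p != 0. Proof. by rewrite gt_eqF. Qed.

(** Large values are cut to 0, not to [M]: the excess is then either 0 or all of [f], so it is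
    dominated by [f] and vanishes at a given point once [M] is large. *)
Definition cut (M x y : R) : R := if f x y <= M then f x y else 0.
Definition excess (M x y : R) : R := if f x y <= M then 0 else f x y.

Lemma cut_excess M : (fun x y => cut M x y + excess M x y) = f.
Proof.
by apply/funext => x; apply/funext => y; rewrite /cut /excess;
  case: ifP; rewrite ?addr0 ?add0r.
Qed.

Lemma cut_ge0 M x y : 0 <= cut M x y.
Proof. by rewrite /cut; case: ifP. Qed.

Lemma excess_ge0 M x y : 0 <= excess M x y.
Proof. by rewrite /excess; case: ifP. Qed.

Lemma cut_le M x y : 0 <= M -> cut M x y <= M.
Proof. by rewrite /cut; case: ifP. Qed.

Lemma measurable_cut M : measurable_fun setT (fun z : R * R => cut M z.1 z.2).
Proof. by apply: measurable_fun_ifT => //; exact: measurable_fun_ler. Qed.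

Lemma measurable_excess M :
  measurable_fun setT (fun z : R * R => excess M z.1 z.2).
Proof. by apply: measurable_fun_ifT => //; exact: measurable_fun_ler. Qed.

Let cost g n w : R := n%:R^-1 * round_cost g alpha (u w) n k.

Lemma cost_cut_excess M n w :
  cost f n w = cost (cut M) n w + cost (excess M) n w.
Proof.
rewrite /cost -mulrDr !round_costE -big_split /=; congr (_ * _).
by apply: eq_bigr => i _; rewrite -key_costD cut_excess.
Qed.

Lemma limit_round_cut_excess M v : limit_round f alpha v k =
  (limit_round (cut M) alpha v k + limit_round (excess M) alpha v k)%E.
Proof.
have mc := measurable_key_cost_section alpha k (measurable_cut M) v.
have me := measurable_key_cost_section alpha k (measurable_excess M) v.
rewrite !limit_round_unif//;
  try exact: measurable_cut; try exact: measurable_excess;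
  try exact: cut_ge0; try exact: excess_ge0.
rewrite -ge0_integralD//; [
  |by move=> x _; rewrite lee_fin key_cost_ge0// => *; exact: cut_ge0
  |exact/measurable_EFinP
  |by move=> x _; rewrite lee_fin key_cost_ge0// => *; exact: excess_ge0
  |exact/measurable_EFinP].
by apply: eq_integral => x _; rewrite -EFinD -key_costD cut_excess.
Qed.

(** Only the limit round of the excess can be infinite, and then the right-hand side is [+oo];
    otherwise this is the triangle inequality between reals. *)
Lemma error_split M n w : 0 < M ->
  (`|(cost f n w)%:E - limit_round f alpha (u w) k| <=
   `|(cost (cut M) n w)%:E - limit_round (cut M) alpha (u w) k| +
   ((cost (excess M) n w)%:E + limit_round (excess M) alpha (u w) k))%E.
Proof.
move=> M0; rewrite (cost_cut_excess M) (limit_round_cut_excess M).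
rewrite -(@limit_round_fineK _ alpha (cut M) M); last 4 first.
- exact: measurable_cut.
- exact: cut_ge0.
- exact: M0.
- by move=> x y; apply: cut_le; exact: ltW.
have e0 : 0 <= cost (excess M) n w.
  rewrite /cost round_costE mulr_ge0 ?invr_ge0// sumr_ge0// => i _.
  by apply: key_cost_ge0; exact: excess_ge0.
have : (0 <= limit_round (excess M) alpha (u w) k)%E.
  by apply: limit_round_ge0; exact: excess_ge0.
case: (limit_round (excess M) alpha (u w) k) => [r|_|//]; last first.
  by rewrite addey// addey// leey.
rewrite lee_fin => r0.
rewrite -EFinD -!EFinB -!EFinD lee_fin.
move: (cost _ _ _) (cost _ _ _) e0 (fine _) => a b b0 c.
rewrite (_ : a + b - (c + r) = (a - c) + (b - r)); last by ring.
apply: (le_trans (ler_normD _ _)); rewrite lerD2l ler_norml.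
by apply/andP; split; lra.
Qed.

Hypothesis fin : (round_Lp_bound U alpha f p k < +oo)%E.

(** Written over the product of [P] and the uniform law, the double integral needs a single
    dominated convergence. The dominating function [F f] is integrable by [fin]. *)
Lemma excess_integral_cvg0 :
  (\int[P]_w limit_round_pow (excess n%:R) alpha p (u w) k
    @[n --> \oo] --> 0)%E.
Proof.
have mkey g : measurable_fun setT (fun z : R * R => g z.1 z.2) ->
    measurable_fun [set: T * measurableTypeR R]
      (fun z => key_cost alpha g (u z.1) k z.2).
  by move=> mg; apply: (measurable_key_cost alpha (v := fun j w => U j w)).
have mpow g : measurable_fun setT (fun z : R * R => g z.1 z.2) ->
    measurable_fun setT (fun z : R * R => g z.1 z.2 `^ p).
  by move=> mg; exact: (measurableT_comp (measurable_powR p)).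
have pow_ge0 g (x y : R) : 0 <= (g x y : R) `^ p by exact: powR_ge0.
pose F (g : R -> R -> R) (z : T * measurableTypeR R) : \bar R :=
  (key_cost alpha (fun x y => g x y `^ p) (u z.1) k z.2)%:E.
have F0 g z : (0 <= F g z)%E by rewrite lee_fin key_cost_ge0.
have mF g : measurable_fun setT (fun z : R * R => g z.1 z.2) ->
    measurable_fun setT (F g).
  by move=> mg; apply/measurable_EFinP; apply: mkey; exact: mpow.
have FE g : measurable_fun setT (fun z : R * R => g z.1 z.2) ->
    (\int[P]_w limit_round_pow g alpha p (u w) k = \int[P \x unif]_z F g z)%E.
  move=> mg; rewrite fubini_tonelli1//; last exact: mF.
  apply: eq_integral => w _; rewrite limit_round_powE limit_round_unif//.
  exact: mpow.
under eq_cvg => n do rewrite (FE _ (measurable_excess n%:R)).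
have [|||||_ _] := @dominated_convergence _ _ _ (P \x unif)%E setT measurableT
  (fun n => F (excess n%:R)) (cst 0%E) (F f).
- by move=> n; apply: mF; exact: measurable_excess.
- exact: measurable_cst.
- apply: aeW => z _; apply: cvg_near_cst.
  rewrite /F /key_cost; case: tau => [t|]; last exact: nearW.
  apply: filterS (nbhs_infty_ger (f z.2 (U t z.1))) => n fn /=.
  by rewrite /excess fn powR0// mulr0.
- apply/integrableP; split; first exact: mF.
  under eq_integral do rewrite gee0_abs//.
  by rewrite -FE//; apply: (lty_poweRy _ fin); rewrite invr_neq0.
- apply: aeW => z n _; rewrite gee0_abs// lee_fin /key_cost.
  case: tau => // t; rewrite ler_wpM2l// ge0_ler_powR ?nnegrE ?excess_ge0//.
    exact: ltW.
  by rewrite /excess; case: ifP.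
by rewrite integral0.
Qed.

Lemma excess_Lp_small (e : R) : 0 < e ->
  exists2 M, 0 < M & (round_Lp_bound U alpha (excess M) p k <= e%:E)%E.
Proof.
move=> e0.
have i0 M : (0 <= \int[P]_w limit_round_pow (excess M) alpha p (u w) k)%E.
  apply: integral_ge0 => w _; rewrite limit_round_powE limit_round_ge0// => x y.
  exact: powR_ge0.
have ep0 : 0 < e `^ p by exact: powR_gt0.
have [N _ NP] := (ge0_cvge0P (fun n => i0 n%:R)).1 excess_integral_cvg0 _ ep0.
(* The successor makes the level positive even if [N = 0]. *)
exists N.+1%:R; first by rewrite ltr0n.
have e_ge0 : (0 <= e%:E)%E by rewrite lee_fin ltW.
rewrite -[leRHS](poweRK pN0 e_ge0); apply: ge0_le_poweR => //.
  by rewrite invr_ge0 ltW.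
by rewrite poweR_EFin; exact: (NP N.+1 (leqnSn N)).
Qed.

Lemma round_cvg :
  ('N[P]_p%:E[(fun w => `|(n%:R^-1 * round_cost f alpha (u w) n k)%:E -
      limit_round f alpha (u w) k|)] @[n --> \oo] --> 0)%E.
Proof.
apply/ge0_cvge0P => [n|e e0]; first exact: Lnorm_ge0.
(* One third for the cut cost and one for each of the two excess terms. *)
have e30 : 0 < e / 3 by rewrite divr_gt0.
have [M M0 MP] := excess_Lp_small e30.
have cutM x y : cut M x y <= M by apply: cut_le; exact: ltW.
have bc :=
  bounded_round_cvg alpha hU k (measurable_cut M) (cut_ge0 M) M0 cutM p1.
have {bc} := (ge0_cvge0P (fun n => Lnorm_ge0 _ _ _)).1 bc _ e30.
apply: filterS => n hn.
have mcost (g : R -> R -> R) :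
    measurable_fun setT (fun z : R * R => g z.1 z.2) ->
    measurable_fun setT (fun w => (cost g n w)%:E).
  move=> mg; apply/measurable_EFinP; apply: measurable_funM => //.
  exact: measurable_round_cost.
have mlim (g : R -> R -> R) :
    measurable_fun setT (fun z : R * R => g z.1 z.2) ->
    (forall x y, 0 <= g x y) ->
    measurable_fun setT (fun w => limit_round g alpha (u w) k).
  by move=> mg g0; exact: measurable_limit_round_seeds.
pose A w := (`|(cost (cut M) n w)%:E - limit_round (cut M) alpha (u w) k|)%E.
pose B w := (cost (excess M) n w)%:E.
pose C w := limit_round (excess M) alpha (u w) k.
have me := measurable_excess M; have mc := measurable_cut M.
have mA : measurable_fun setT A.
  apply: measurableT_comp => //; apply: emeasurable_funB; first exact: mcost.
  by apply: mlim => //; exact: cut_ge0.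
have mB : measurable_fun setT B by exact: mcost.
have mC : measurable_fun setT C by apply: mlim => //; exact: excess_ge0.
have B0 w : (0 <= B w)%E.
  rewrite lee_fin /cost round_costE mulr_ge0 ?invr_ge0// sumr_ge0// => i _.
  by apply: key_cost_ge0; exact: excess_ge0.
have C0 w : (0 <= C w)%E by apply: limit_round_ge0; exact: excess_ge0.
apply: (@le_trans _ _ ('N[P]_p%:E[(A \+ (B \+ C))])%E).
  apply: le_Lnorm => //.
  - apply: measurableT_comp => //; apply: emeasurable_funB; first exact: mcost.
    exact: mlim.
  - by apply: emeasurable_funD => //; exact: emeasurable_funD.
  - move=> w; rewrite abse_id [leRHS]gee0_abs; last first.
      by rewrite /= /A !adde_ge0.
    exact: error_split.
have mBC : measurable_fun setT (B \+ C)%E by exact: emeasurable_funD.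
have A0 w : (0 <= A w)%E by exact: abse_ge0.
have BC0 w : (0 <= (B \+ C) w)%E by rewrite /= adde_ge0.
apply: (le_trans (ge0_minkowski P p1 mA mBC A0 BC0)).
rewrite (_ : e%:E = (e / 3)%:E + ((e / 3)%:E + (e / 3)%:E))%E; last first.
  by rewrite -!EFinD; congr EFin; field.
apply: leeD; first by rewrite /A (Lnorm_abse P).
apply: (le_trans (ge0_minkowski P p1 mB mC _ _)) => //.
apply: leeD; apply: le_trans MP.
  by apply: Lnorm_round_cost_le => //; exact: excess_ge0.
by apply: Lnorm_limit_round_le => //; exact: excess_ge0.
Qed.

End round_convergence.

(** * Series of nonnegative extended reals *)

Section extended_series.
Context {R : realType}.
Local Open Scope ereal_scope.

(** Finite terms [a k] keep both inequalities between [a k] and [b k] valid even for infinite [b k].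
    Summing these inequalities avoids subtracting series term by term. *)
Lemma abse_nneseriesB (a b : nat -> \bar R) :
  (forall k, 0 <= a k) -> (forall k, a k \is a fin_num) ->
  (forall k, 0 <= b k) -> \sum_(k <oo) a k < +oo ->
  `|\sum_(k <oo) a k - \sum_(k <oo) b k| <= \sum_(k <oo) `|a k - b k|.
Proof.
move=> a0 afin b0 aoo; set D := leRHS.
have D0 : 0 <= D by exact: nneseries_ge0.
have ba k : b k <= a k + `|a k - b k|.
  move: (afin k) (b0 k); case: (a k) => // r _; case: (b k) => [s _|_|//].
    by rewrite -EFinB -EFinD lee_fin; have := ler_norm (s - r); rewrite distrC; lra.
  by rewrite addeNy.
have ab k : a k <= b k + `|a k - b k|.
  move: (afin k) (b0 k); case: (a k) => // r _; case: (b k) => [s _|_|//].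
    by rewrite -EFinB -EFinD lee_fin; have := ler_norm (r - s); lra.
  by rewrite addye ?leey// -ltNye (lt_le_trans _ (abse_ge0 _)).
have BA : \sum_(k <oo) b k <= \sum_(k <oo) a k + D.
  by rewrite /D -nneseriesD//; apply: lee_nneseries.
have AB : \sum_(k <oo) a k <= \sum_(k <oo) b k + D.
  by rewrite /D -nneseriesD//; apply: lee_nneseries.
have A0 : 0 <= \sum_(k <oo) a k by exact: nneseries_ge0.
have B0 : 0 <= \sum_(k <oo) b k by exact: nneseries_ge0.
move: aoo A0 B0 D0 BA AB; move: D (\sum_(k <oo) a k) (\sum_(k <oo) b k).
move=> [D||] [A||] [B||] //= _ _ _ _; rewrite ?leey//.
by rewrite !lee_fin => h1 h2; rewrite ler_norml; apply/andP; split; lra.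
Qed.

(** Dominated convergence for the counting measure on [nat]. *)
Lemma nneseries_dominated_cvg0 (a : nat -> nat -> \bar R) (b : nat -> \bar R) :
  (forall n k, 0 <= a n k) -> (forall n k, a n k <= b k) ->
  \sum_(k <oo) b k < +oo -> (forall k, a n k @[n --> \oo] --> 0) ->
  \sum_(k <oo) a n k @[n --> \oo] --> 0.
Proof.
move=> a0 ab boo acvg.
have b0 k : 0 <= b k by exact: le_trans (ab 0%N k).
have [|||||_ _] := @dominated_convergence _ _ _ (@counting nat R) setT
  measurableT a (cst 0) b.
- by [].
- exact: measurable_cst.
- by apply: aeW => k _; exact: acvg.
- apply/integrableP; split => //.
  under eq_integral do rewrite gee0_abs//.
  by rewrite ge0_integral_count.
- by apply: aeW => k n _; rewrite gee0_abs.
rewrite integral0; apply: cvg_trans; apply: near_eq_cvg; apply: nearW => n /=.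
by rewrite ge0_integral_count.
Qed.

End extended_series.

(** * From norms to probability to distribution *)

Section modes_of_convergence.
Context {R : realType} {d : measure_display} {T : measurableType d}.
Variables (P : probability T R) (p : R).
Hypothesis p1 : 1 <= p.
Variables (X_ : nat -> T -> \bar R) (X : T -> \bar R).
Hypothesis mX_ : forall n, measurable_fun setT (X_ n).
Hypothesis mX : measurable_fun setT X.
Let p0 : 0 < p. Proof. exact: lt_le_trans ltr01 p1. Qed.
Let pN0 : p != 0. Proof. by rewrite gt_eqF. Qed.

Let mE (e : R) n : measurable [set w | (e%:E < `|X_ n w - X w|)%E].
Proof.
rewrite -[X in measurable X]setTI; apply: emeasurable_fun_o_infty => //.
by apply: measurableT_comp => //; exact: emeasurable_funB.
Qed.

Lemma Lnorm_cvg_in_probability :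
  ('N[P]_p%:E[(fun w => X_ n w - X w)] @[n --> \oo] --> 0)%E ->
  cvg_in_probability P X_ X.
Proof.
move=> h e e0; apply/ge0_cvge0P => // eta eta0.
(* The [p]-th power of this threshold is [e ^ p] times [eta], so Markov's inequality for the [p]-th
   power leaves exactly [eta]. *)
have eta_e : 0 < e * eta `^ p^-1 by rewrite mulr_gt0// powR_gt0.
have := (ge0_cvge0P (fun n => Lnorm_ge0 _ _ _)).1 h _ eta_e.
apply: filterS => n hn.
have mZ : measurable_fun setT (fun w => X_ n w - X w)%E.
  exact: emeasurable_funB.
have ep : (0 < (e `^ p)%:E)%E by rewrite lte_fin powR_gt0.
have epfin : (e `^ p)%:E \is a fin_num by [].
rewrite -(@lee_pmul2l _ (e `^ p)%:E)//.
have mpow : measurable_fun setT (fun x : \bar R => x `^ p)%E.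
  exact: measurable_poweR.
have mono : {in (`[0%E, +oo[%classic : set (\bar R)) &,
    {homo (fun x : \bar R => x `^ p)%E : x y / (x <= y)%E}}.
  move=> x y; rewrite inE/= in_itv/= andbT => x0 _ xy.
  by apply: ge0_le_poweR => //; exact: ltW.
have markov := @le_integral_comp_abse _ _ _ P setT measurableT _ e _ mpow
  (fun r _ => poweR_ge0 r p) mono mZ e0.
have sub : (P [set w | e%:E < `|X_ n w - X w|] <=
    P (setT `&` [set w | e%:E <= `|X_ n w - X w|]))%E.
  apply: le_measure; rewrite ?inE//.
    apply: emeasurable_fun_c_infty => //.
    exact: measurableT_comp.
  by move=> w /= /ltW.
rewrite -poweR_EFin; apply: (le_trans (lee_wpmul2l (poweR_ge0 _ _) sub)).
apply: (le_trans markov); rewrite -poweR_Lnorm//.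
apply: (le_trans (ge0_le_poweR (ltW p0) (Lnorm_ge0 _ _ _) hn)).
rewrite !poweR_EFin -EFinM lee_fin powRM ?(ltW e0) ?powR_ge0//.
by rewrite -powRrM mulVf// powRr1// ltW.
Qed.

(** The distribution function of [X_ n] at [x] lies between those of [X] at [x - e] and [x + e], up
    to the probability of a deviation above [e]. *)
Lemma cvg_in_probability_in_distribution :
  cvg_in_probability P X_ X -> cvg_in_distribution P X_ X.
Proof.
move=> cvgP x contx.
pose F y := P [set w | (X w <= y%:E)%E].
pose G n := P [set w | (X_ n w <= x%:E)%E].
pose Q e n := P [set w | (e%:E < `|X_ n w - X w|)%E].
have mle (Y : T -> \bar R) y : measurable_fun setT Y ->
    measurable [set w | (Y w <= y%:E)%E].
  by move=> mY; rewrite -[X in measurable X]setTI; exact: emeasurable_fun_infty_c.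
have mF y : measurable [set w | (X w <= y%:E)%E] by exact: mle.
have mG n : measurable [set w | (X_ n w <= x%:E)%E] by exact: mle.
have Ffin y : F y \is a fin_num by exact: fin_num_measure.
have Gfin n : G n \is a fin_num by exact: fin_num_measure.
have Qfin (e : R) n : Q e n \is a fin_num by exact: fin_num_measure.
have GF (e : R) n : 0 < e -> (G n <= F (x + e)%R + Q e n)%E.
  move=> e0; apply: le_trans (measureU2 _ (mF _) (mE e n)).
  apply: le_measure; rewrite ?inE//; first exact: measurableU.
  move=> w /=.
  (* [X w = -oo] gives the left alternative; in the other cases with an infinite value the distance
     is [+oo] or the assumption fails. *)
  case: (X_ n w) (X w) => [r||] [s||] //=;
    try (by move=> _; left; rewrite ?leNye ?leey);
    try (by move=> _; right; rewrite ?ltry).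
  rewrite !lee_fin lte_fin => rx.
  have [sx|sx] := leP s (x + e); [by left|right].
  by rewrite ltr_normr; apply/orP; right; lra.
have FG (e : R) n : 0 < e -> (F (x - e)%R <= G n + Q e n)%E.
  move=> e0; apply: le_trans (measureU2 _ (mG _) (mE e n)).
  apply: le_measure; rewrite ?inE//; first exact: measurableU.
  move=> w /=.
  case: (X_ n w) (X w) => [r||] [s||] //=;
    try (by move=> _; left; rewrite ?leNye ?leey);
    try (by move=> _; right; rewrite ?ltry).
  rewrite !lee_fin lte_fin => sx.
  have [rx|rx] := leP r x; [by left|right].
  by rewrite ltr_normr; apply/orP; left; lra.
have Fcont : (fine \o F) y @[y --> x] --> fine (F x).
  by apply: fine_cvg; rewrite fineK.
rewrite -[X in _ --> X](fineK (Ffin x)).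
apply/fine_cvgP; split; first exact: nearW.
apply/cvgrPdist_le => eta eta0.
have eta20 : 0 < eta / 2 by rewrite divr_gt0.
have /cvgrPdist_le/(_ _ eta20) [r /= r0 rP] := Fcont.
(* Half the radius of continuity puts [x - e] and [x + e] strictly inside the ball. *)
pose e := r / 2; have e0 : 0 < e by rewrite divr_gt0.
have xe y : `|y - x| = e -> `|fine (F x) - fine (F y)| <= eta / 2.
  move=> yx; apply: rP; rewrite /= distrC yx /e.
  by rewrite ltr_pdivrMr// ltr_pMr// ltr1n.
have Qcvg := (ge0_cvge0P (fun n => measure_ge0 _ _)).1 (cvgP e e0) _ eta20.
apply: filterS Qcvg => n Qn.
have h1 := GF e n e0; have h2 := FG e n e0.
have h3 : `|fine (F x) - fine (F (x + e))| <= eta / 2.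
  by apply: xe; rewrite addrC addKr gtr0_norm.
have h4 : `|fine (F x) - fine (F (x - e))| <= eta / 2.
  by apply: xe; rewrite addrC addKr normrN gtr0_norm.
move: h1 h2 h3 h4 Qn => /=; rewrite -/(G n) -/(Q e n).
rewrite -(fineK (Ffin (x + e))) -(fineK (Ffin (x - e))) -(fineK (Gfin n)).
rewrite -(fineK (Qfin e n)) -!EFinD !lee_fin /= !ler_norml.
by move=> ? ? /andP[? ?] /andP[? ?] ?; apply/andP; split; lra.
Qed.

End modes_of_convergence.

(** * Extension of the cost off the unit square *)

Section extended_cost.
Context {R : realType}.
Variable beta : R -> R -> R.
Hypothesis hbeta : cost_function beta.

(* [beta] is constrained on the open unit square only; the process never
   evaluates it elsewhere, and this extension is measurable everywhere. *)
Definition extended_cost (x y : R) : R :=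
  if (0 < x < 1) && (0 < y < 1) then beta x y else 0.

Lemma extended_cost_ge0 x y : 0 <= extended_cost x y.
Proof.
have [_ beta0 _] := hbeta; rewrite /extended_cost; case: ifP => // /andP[x01 y01].
exact: beta0.
Qed.

Lemma measurable_extended_cost :
  measurable_fun setT (fun z : R * R => extended_cost z.1 z.2).
Proof.
have [mbeta _ _] := hbeta.
have mD : measurable (`]0, 1[%classic `*` `]0, 1[%classic : set (R * R)).
  by apply: measurableX; exact: measurable_itv.
rewrite (_ : (fun z => _) =
  (fun z => beta z.1 z.2) \_ (`]0, 1[%classic `*` `]0, 1[%classic)).
  exact/(measurable_restrictT _ mD).
apply/funext => z; rewrite patchE /extended_cost.
case: ifP => [/andP[z1 z2]|z12]; case: ifPn => //.
  by rewrite notin_setE /= !in_itv /= => /(_ (conj z1 z2)).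
by rewrite inE /= !in_itv /= => -[z1 z2]; rewrite z1 z2 in z12.
Qed.

Lemma key_cost_extended alpha (u : nat -> R) k :
  key_cost alpha beta u k = key_cost alpha extended_cost u k.
Proof.
apply/funext => x; apply: eq_key_cost => {}x y x01 y01.
by rewrite /extended_cost x01 y01.
Qed.

Lemma round_cost_extended alpha (u : nat -> R) n k :
  round_cost beta alpha u n k = round_cost extended_cost alpha u n k.
Proof.
by rewrite !round_costE; apply: eq_bigr => i _; rewrite key_cost_extended.
Qed.

Lemma limit_round_extended alpha (u : nat -> R) k :
  limit_round beta alpha u k = limit_round extended_cost alpha u k.
Proof. by rewrite !limit_roundE key_cost_extended. Qed.

Lemma limit_round_pow_extended alpha p (u : nat -> R) k : p != 0 ->
  limit_round_pow beta alpha p u k = limit_round_pow extended_cost alpha p u k.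
Proof.
move=> p0; rewrite !limit_round_powE !limit_roundE.
by apply: eq_integral => x _; rewrite !key_cost_powR// key_cost_extended.
Qed.

End extended_cost.

(** * Summation over the rounds *)

Theorem theorem3p1 (R : realType) (d : measure_display)
    (T : measurableType d) (P : probability T R)
    (U : nat -> {RV P >-> R}) (alpha : R) (beta : R -> R -> R) (p : R)
    (hU : iid_uniform01 U)
    (halpha : 0 <= alpha <= 1)
    (hbeta : cost_function beta)
    (hp : 1 <= p)
    (hsum : (\sum_(0 <= k <oo)
        (\int[P]_w limit_round_pow beta alpha p (fun i => U i w) k) `^ p^-1
        < +oo)%E) :
  let X_ := fun (n : nat) (w : T) =>
    ((n%:R^-1)%:E * quickval_cost beta alpha (fun i => U i w) n)%E in
  let S := fun w : T => limit_cost beta alpha (fun i => U i w) in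
  [/\ cvg_in_Lp P p X_ S,
      cvg_in_probability P X_ S &
      cvg_in_distribution P X_ S].
Proof.
move=> X_ S.
have p0 : p != 0 by rewrite gt_eqF// (lt_le_trans ltr01).
pose f := extended_cost beta.
have mf : measurable_fun setT (fun z : R * R => f z.1 z.2).
  exact: measurable_extended_cost.
have f0 x y : 0 <= f x y by exact: extended_cost_ge0.
have boundE k : (\int[P]_w limit_round_pow beta alpha p (fun i => U i w) k)%E =
    (\int[P]_w limit_round_pow f alpha p (fun i => U i w) k)%E.
  by apply: eq_integral => w _; exact: limit_round_pow_extended.
have [b bE] : exists b, b = round_Lp_bound U alpha f p by eexists.
have b0 k : (0 <= b k)%E by rewrite bE; exact: poweR_ge0.
have {hsum boundE} boo : (\sum_(k <oo) b k < +oo)%E.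
  rewrite bE; apply: le_lt_trans hsum.
  apply: lee_nneseries => [k _ _|k _]; first exact: poweR_ge0.
  by rewrite boundE.
(* A term of a finite series of nonnegative terms is finite; the convergence of each single round
   requires it. *)
have bfin k : (b k < +oo)%E.
  apply: le_lt_trans boo; rewrite (nneseriesD1 (n := k))//.
  by rewrite leeDl//; exact: nneseries_ge0.
pose a n k w : \bar R :=
  (n%:R^-1 * round_cost f alpha (fun i => U i w) n k)%:E.
pose l k w : \bar R := limit_round f alpha (fun i => U i w) k.
have rc0 n k w : 0 <= round_cost f alpha (fun i => U i w) n k.
  by rewrite round_costE sumr_ge0// => i _; exact: key_cost_ge0.
have a0 n k w : (0 <= a n k w)%E by rewrite lee_fin mulr_ge0 ?invr_ge0.
have l0 k w : (0 <= l k w)%E by exact: limit_round_ge0.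
have ma n k : measurable_fun setT (a n k).
  apply/measurable_EFinP; apply: measurable_funM => //.
  exact: measurable_round_cost.
have ml k : measurable_fun setT (l k) by exact: measurable_limit_round_seeds.
have X_E n : X_ n = (fun w => \sum_(0 <= k <oo) a n k w)%E.
  apply/funext => w; rewrite /X_ /quickval_cost -nneseriesZl; last first.
    by move=> k _; rewrite round_cost_extended lee_fin.
  by apply: eq_eseriesr => k _; rewrite round_cost_extended.
have SE : S = (fun w => \sum_(0 <= k <oo) l k w)%E.
  apply/funext => w; apply: eq_eseriesr => k _.
  by rewrite limit_round_extended.
have mseries (h : nat -> T -> \bar R) : (forall k, measurable_fun setT (h k)) ->
    (forall k w, (0 <= h k w)%E) ->
    measurable_fun setT (fun w => \sum_(0 <= k <oo) h k w)%E.
  by move=> mh h0; apply: (ge0_emeasurable_sum (P := xpredT)).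
have mX_ n : measurable_fun setT (X_ n) by rewrite X_E; exact: mseries.
have mS : measurable_fun setT S by rewrite SE; exact: mseries.
have a_le n k : ('N[P]_p%:E[a n k] <= b k)%E.
  by rewrite bE; exact: Lnorm_round_cost_le.
have l_le k : ('N[P]_p%:E[l k] <= b k)%E.
  by rewrite bE; exact: Lnorm_limit_round_le.
pose g n k w := (`|a n k w - l k w|)%E.
have mg n k : measurable_fun setT (g n k).
  by apply: measurableT_comp => //; exact: emeasurable_funB.
have g0 n k w : (0 <= g n k w)%E by exact: abse_ge0.
(* One [b k] for the cost and one for its limit: a summable bound on the round errors, uniform in
   [n]. *)
have g_le n k : ('N[P]_p%:E[g n k] <= b k + b k)%E.
  apply: (@le_trans _ _ ('N[P]_p%:E[(a n k \+ l k)])%E).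
    apply: le_Lnorm => //; first exact: emeasurable_funD.
    move=> w; rewrite abse_id (le_trans (lee_abs_sub _ _))//.
    by rewrite !gee0_abs// adde_ge0.
  apply: (le_trans (ge0_minkowski P hp (ma n k) (ml k) (a0 n k) (l0 k))).
  exact: leeD.
have X_S_le n w : (`|X_ n w - S w| <= \sum_(k <oo) g n k w)%E.
  rewrite X_E SE; apply: abse_nneseriesB => //.
  (* Rounds numbered [n] and above cost nothing with [n] keys, so the series of costs is a finite
     sum of reals. *)
  rewrite (nneseries_split 0 n)// eseries0 ?adde0; last first.
    by move=> k nk _; rewrite /a round_cost_eq0// mulr0.
  by rewrite add0n /a sumEFin ltry.
have LpX_S : ('N[P]_p%:E[(fun w => X_ n w - S w)] @[n --> \oo] --> 0)%E.
  apply: (@squeeze_cvge _ _ _ _ (cst 0%E) _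
      (fun n => \sum_(k <oo) 'N[P]_p%:E[g n k])%E).
  - apply: nearW => n; rewrite Lnorm_ge0/=.
    apply: le_trans (ge0_minkowski_series P hp (mg n) (g0 n)).
    apply: le_Lnorm => //; [exact: emeasurable_funB|exact: mseries|move=> w].
    by rewrite [leRHS]gee0_abs//; exact: nneseries_ge0.
  - exact: cvg_cst.
  - apply: (@nneseries_dominated_cvg0 _ _ (fun k => b k + b k)%E) => //.
    + by move=> n k; exact: Lnorm_ge0.
    + by rewrite nneseriesD// lte_add_pinfty.
    + by move=> k; apply: round_cvg => //; rewrite -bE.
have probX_S := Lnorm_cvg_in_probability hp mX_ mS LpX_S.
split => //; last exact: cvg_in_probability_in_distribution.
split => // [n|]; split => //; apply: le_lt_trans boo.
  rewrite X_E; apply: (le_trans (ge0_minkowski_series P hp (ma n) (a0 n))).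
  by apply: lee_nneseries => // *; exact: Lnorm_ge0.
rewrite SE; apply: (le_trans (ge0_minkowski_series P hp ml l0)).
by apply: lee_nneseries => // *; exact: Lnorm_ge0.
Qed.
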